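(* Let $u_0\in H^1(S^1)$, let $(\rho,\rho_t)$ be the global solution (defined for all $t\ge 0$, with $\int_0^1\rho(t,x)^2dx=1$) of the Cauchy problem described in the context, and let $$\eta(t,x)=\int_0^x \rho(t,y)^2\,dy+t\,u_0(0)-\int_0^t\int_0^\tau H(s,0)\,ds\,d\tau$$ be the Lagrangian flow of the corresponding weak solution $u$ of the Camassa–Holm equation (so that $u(t,\eta(t,x))=G(t,x)$). Then for every $t\ge0$ the map $x\mapsto \eta(t,x)$ is absolutely continuous. Furthermore, if $k\ge1$ and $u_0\in C^k(S^1)$, then $x\mapsto\eta(t,x)$ is of class $C^k$ for all $t\ge 0$.
   Context: $S^1=\mathbb{R}/\mathbb{Z}$; functions on $S^1$ are $1$-periodic functions on $[0,1]$. Let $u_0\in H^1(S^1)$ and $\mu=\int_0^1u_0\,dx$. For $\rho,\sigma\in L^2(S^1)$ define $$G(\rho,\sigma)(x)=\int_0^x 2\rho\sigma\,dy+\mu-\int_0^1\Big(\int_0^y 2\rho\sigma\,dz\Big)\rho(y)^2\,dy,$$ $$F(\rho,\sigma)(x)=\int_0^1\frac{\cosh\big(\big|\int_y^x\rho(z)^2dz\big|-\tfrac12\big)}{2\sinh(1/2)}\big(\rho(y)^2G(y)^2+2\sigma(y)^2\big)\,dy,\qquad f(\rho,\sigma)=\tfrac12\rho\,(G^2-F),$$ with $G=G(\rho,\sigma)$. The Cauchy problem is the ODE on $L^2(S^1)\times L^2(S^1)$: $\frac{d\rho}{dt}=\rho_t$, $\frac{d\rho_t}{dt}=f(\rho,\rho_t)$,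 $\rho(0)=1$ (constant function), $\rho_t(0)=\tfrac12u_0'$. Along the solution write $G(t,x)=G(\rho(t),\rho_t(t))(x)$ and $$H(t,x)=\int_0^x\frac{\sinh\big(\int_y^x\rho^2dz-\tfrac12\big)}{2\sinh(1/2)}(\rho^2G^2+2\rho_t^2)(y)\,dy+\int_x^1\frac{\sinh\big(-\int_y^x\rho^2dz-\tfrac12\big)}{2\sinh(1/2)}(\rho^2G^2+2\rho_t^2)(y)\,dy.$$ *)

(* Defs.v *)
From HB Require Import structures.
From mathcomp Require Import all_boot all_order all_algebra.
From mathcomp Require Import all_classical all_reals all_analysis.
Set Implicit Arguments. Unset Strict Implicit. Unset Printing Implicit Defensive.
Import Order.TTheory GRing.Theory Num.Theory.
Import numFieldNormedType.Exports.
Local Open Scope classical_set_scope.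
Local Open Scope ring_scope.

Definition intab (R : realType) (a b : R) (f : R -> R) : R :=
  Rintegral (@lebesgue_measure R) `[a, b] f.

Definition oint (R : realType) (a b : R) (f : R -> R) : R :=
  if a <= b then intab a b f else - intab b a f.

Definition sinhR (R : realType) (z : R) : R := (expR z - expR (- z)) / 2.
Definition coshR (R : realType) (z : R) : R := (expR z + expR (- z)) / 2.

(* 1-periodic functions on R = functions on S^1 = R/Z. *)
Definition periodic1 (R : realType) (f : R -> R) : Prop :=
  forall x, f (x + 1) = f x.

Definition inL2 (R : realType) (f : R -> R) : Prop :=
  measurable_fun (`[0, 1] : set R) f /\
  (@lebesgue_measure R).-integrable (`[0, 1] : set R) (fun x => (f x ^+ 2)%:E).

Definition L2norm (R : realType) (f : R -> R) : R :=
  Num.sqrt (intab 0 1 (fun x => f x ^+ 2)).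

(* G(rho,sigma), with mu = mean of u0. *)
Definition Gop (R : realType) (mu : R) (rho sigma : R -> R) (x : R) : R :=
  oint 0 x (fun y => 2 * rho y * sigma y) + mu
  - intab 0 1 (fun y => oint 0 y (fun z => 2 * rho z * sigma z) * rho y ^+ 2).

Definition Fop (R : realType) (mu : R) (rho sigma : R -> R) (x : R) : R :=
  intab 0 1 (fun y =>
    coshR (`| oint y x (fun z => rho z ^+ 2) | - 1 / 2) / (2 * sinhR (1 / 2))
    * (rho y ^+ 2 * Gop mu rho sigma y ^+ 2 + 2 * sigma y ^+ 2)).

Definition fop (R : realType) (mu : R) (rho sigma : R -> R) (x : R) : R :=
  1 / 2 * rho x * (Gop mu rho sigma x ^+ 2 - Fop mu rho sigma x).

(* H(t,x), given rho = rho(t), sigma = rho_t(t). *)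
Definition Hop (R : realType) (mu : R) (rho sigma : R -> R) (x : R) : R :=
  let w := fun y => rho y ^+ 2 * Gop mu rho sigma y ^+ 2 + 2 * sigma y ^+ 2 in
  intab 0 x (fun y =>
     sinhR (oint y x (fun z => rho z ^+ 2) - 1 / 2) / (2 * sinhR (1 / 2)) * w y)
  + intab x 1 (fun y =>
     sinhR (- oint y x (fun z => rho z ^+ 2) - 1 / 2) / (2 * sinhR (1 / 2)) * w y).

Definition abs_cont_on (R : realType) (a b : R) (f : R -> R) : Prop :=
  forall e : R, 0 < e -> exists2 d : R, 0 < d &
    forall (n : nat) (x y : nat -> R),
      (forall i, (i < n)%N -> a <= x i /\ x i <= y i /\ y i <= b) ->
      (forall i j, (i < n)%N -> (j < n)%N -> i <> j -> y i <= x j \/ y j <= x i) ->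
      \sum_(i < n) (y i - x i) < d ->
      \sum_(i < n) `| f (y i) - f (x i) | < e.

Definition Ck (R : realType) (k : nat) (f : R -> R) : Prop :=
  (forall i, (i < k)%N -> forall x, derivable (derive1n i f) x 1) /\
  continuous (derive1n k f).

(* L^2-valued derivative on [0,oo): d/dt X(t) = Y(t) at t (one-sided at t = 0). *)
Definition L2_deriv_at (R : realType) (X Y : R -> R -> R) (t : R) : Prop :=
  forall e : R, 0 < e -> exists2 d : R, 0 < d &
    forall h : R, h != 0 -> `|h| < d -> 0 <= t + h ->
      L2norm (fun x => (X (t + h) x - X t x) / h - Y t x) < e.

Definition lagr_flow (R : realType) (u0 : R -> R) (rho rhot : R -> R -> R) (t x : R) : R :=
  let mu := intab 0 1 u0 in
  oint 0 x (fun y => rho t y ^+ 2) + t * u0 0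
  - oint 0 t (fun tau => oint 0 tau (fun s => Hop mu (rho s) (rhot s) 0)).

(* Main.v *)
(* For fixed x the equation reads rho_tt = A rho with A(t, x) = (G^2 - F) / 2, a linear
   second-order equation in t whose coefficient depends on (rho, rho_t) only through
   integrals in x.  First, A is jointly continuous, because t |-> (rho, rho_t) is
   continuous in L^2.  Let phi(t, x) be the pointwise solution of phi_tt = A phi with
   phi(0) = 1, phi_t(0) = u0' / 2; a Gronwall argument for the L^2 norm of
   (rho - phi, rho_t - phi_t) gives rho(t) = phi(t) almost everywhere.  If phi and phi_t
   are C^i in x then A is C^(i+1) in x, because of the extra integration, and hence
   so are phi and phi_t, as long as u0' is C^(i+1).  So phi is C^(k-1) and the integral
   of phi^2 is C^k.  The point x = 0 of the circle causes no trouble, since the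
   derivative of int rho^2 = 1 gives int rho rho_t = 0, which makes G and F periodic. *)
Require Import Defs.
From HB Require Import structures.
From mathcomp Require Import all_boot all_order all_algebra.
From mathcomp Require Import all_classical all_reals all_analysis.
From mathcomp Require Import measurable_realfun.
From mathcomp Require Import ring lra.
Set Implicit Arguments. Unset Strict Implicit. Unset Printing Implicit Defensive.
Import Order.TTheory GRing.Theory Num.Theory.
Import numFieldNormedType.Exports.
Local Open Scope classical_set_scope.
Local Open Scope ring_scope.

(** * Interval integrals of locally integrable functions on the line *)

Section Integrals.
Variable R : realType.
Notation mu := (@lebesgue_measure R).
Implicit Types (a b c x y : R) (f g h : R -> R).

(** An element of L^2 has no value at a point, so fixing x in the equation for [rho] is meaningless.
    The coefficient A, however, is a genuine continuous function once (rho, rho_t) is given;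
    freezing it makes the equation for phi linear with x as a parameter, and no fixed point in a
    function space is needed. The equation is used in integrated form: phi is c plus the double time
    primitive of A phi, with c = 1 + t u0'/2. If |A| <= K and 2K <= L^2, this double primitive
    contracts by 1/2 in the norm weighted by e^{-Lt}. This one estimate gives existence for all
    times, the Gronwall bound and differentiability in x. Everything is extended to negative times,
    by clipping t at 0 or by primitives that vanish there, so that continuity is always continuity
    on the plane. Likewise the estimates in x live on arbitrary segments, whence [lint]: the
    conclusions concern all real x, and phi is never treated as periodic. In the flow only the
    integral of rho^2 depends on x; the terms with u0(0) and H are constants. *)

Definition lint f := forall a b, mu.-integrable `[a, b] (EFin \o f).

Lemma lint_meas f a b : lint f -> measurable_fun (`[a, b] : set R) f.
Proof. by move=> /(_ a b)/integrableP[/measurable_EFinP]. Qed.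

Lemma lint_cont f : continuous f -> lint f.
Proof.
move=> cf a b; apply: continuous_compact_integrable; first exact: segment_compact.
by apply: continuous_subspaceT => x; exact: cf.
Qed.

Lemma lint_cst k : lint (cst k).
Proof. by apply: lint_cont => x; exact: cst_continuous. Qed.

Lemma lintD f g : lint f -> lint g -> lint (fun x => f x + g x).
Proof.
by move=> lf lg a b; apply: (@integrableD _ _ _ mu _ _ (EFin \o f) (EFin \o g)).
Qed.

Lemma lintZ k f : lint f -> lint (fun x => k * f x).
Proof.
by move=> lf a b; apply: (@integrableZl _ _ _ mu _ _ k (EFin \o f)).
Qed.

Lemma lintB f g : lint f -> lint g -> lint (fun x => f x - g x).
Proof.
move=> lf lg; have := lintD lf (lintZ (-1) lg).
by under [X in lint X]eq_fun do rewrite mulN1r.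
Qed.

Lemma lint_le f g : (forall a b, measurable_fun (`[a, b] : set R) f) ->
  (forall x, `|f x| <= g x) -> lint g -> lint f.
Proof.
move=> mf fg lg a b.
apply: (@le_integrable _ _ _ mu _ _ _ (EFin \o g)) => //.
- by apply/measurable_EFinP; exact: mf.
- by move=> x _ /=; rewrite lee_fin (le_trans (fg x))// ler_norm.
Qed.

Lemma lint_norm f : lint f -> lint (fun x => `|f x|).
Proof.
by move=> lf a b; have := integrable_norm (lf a b).
Qed.

Lemma lint_mulc f g : continuous f -> lint g -> lint (fun x => f x * g x).
Proof.
move=> cf lg a b.
have [M Mf] : exists M, forall x, x \in `[a, b] -> `|f x| <= M.
  have [ab|ba] := leP a b; last first.
    by exists 0 => x; rewrite in_itv/= => /andP[/le_trans/[apply]]; rewrite leNgt ba.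
  have := @EVT_max R (fun x => `|f x|) a b ab _.
  case=> [|c _ Hc]; last by exists `|f c|.
  apply: continuous_subspaceT => x.
  by apply: (@continuous_comp _ _ _ f (fun z => `|z|)); [exact: cf|exact: norm_continuous].
have mf : measurable_fun (`[a, b] : set R) f by exact: lint_meas (lint_cont cf).
apply: (@le_integrable _ _ _ mu _ _ _ (EFin \o (fun x => M * g x))).
- by [].
- by apply/measurable_EFinP/measurable_funM => //; exact: lint_meas lg.
- move=> x xab /=; rewrite lee_fin !normrM ler_wpM2r//.
  by rewrite (le_trans (Mf _ _))// ler_norm.
- exact: (lintZ M lg).
Qed.

Lemma intabD a b f g : lint f -> lint g ->
  intab a b (fun x => f x + g x) = intab a b f + intab a b g.
Proof. by move=> lf lg; rewrite /intab RintegralD. Qed.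

Lemma intabB a b f g : lint f -> lint g ->
  intab a b (fun x => f x - g x) = intab a b f - intab a b g.
Proof. by move=> lf lg; rewrite /intab RintegralB. Qed.

Lemma intabZ a b k f : lint f -> intab a b (fun x => k * f x) = k * intab a b f.
Proof. by move=> lf; rewrite /intab RintegralZl. Qed.

Lemma intab_ge0 a b f : (forall x, 0 <= f x) -> 0 <= intab a b f.
Proof. by move=> f0; apply: Rintegral_ge0 => x _. Qed.

Lemma eq_intab a b f g : (forall x, a <= x <= b -> f x = g x) ->
  intab a b f = intab a b g.
Proof.
by move=> fg; apply: eq_Rintegral => x; rewrite inE/= in_itv/=; exact: fg.
Qed.

Lemma le_intab a b f g : lint f -> lint g ->
  (forall x, a <= x <= b -> f x <= g x) -> intab a b f <= intab a b g.
Proof.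
by move=> lf lg fg; apply: le_Rintegral.
Qed.

Lemma intab_gt a b f : b < a -> intab a b f = 0.
Proof. by move=> ba; rewrite /intab set_itv_ge ?Rintegral_set0// bnd_simp -ltNge. Qed.

Lemma intab_xx a f : intab a a f = 0.
Proof. by rewrite /intab set_itv1 Rintegral_set1. Qed.

Lemma intab_cst a b k : a <= b -> intab a b (fun=> k) = k * (b - a).
Proof.
move=> ab; rewrite /intab Rintegral_cst//= lebesgue_measure_itv/= lte_fin.
by case: ltgtP ab => // -> _; rewrite subrr.
Qed.

Lemma norm_intab a b f : lint f -> `|intab a b f| <= intab a b (fun x => `|f x|).
Proof. by move=> lf; exact: le_normr_Rintegral. Qed.

Lemma intab_split a b c f : lint f -> a <= b -> b <= c ->
  intab a c f = intab a b f + intab b c f.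
Proof.
move=> lf ab bc; apply/eqP; rewrite addrC -subr_eq; apply/eqP.
rewrite /intab Rintegral_itvB//.
by rewrite Rintegral_itv_obnd_cbnd//; apply: integrableS (lf b c) => //;
  exact: subset_itv_oc_cc.
Qed.

Lemma intab_bound a b f M : lint f -> a <= b ->
  (forall x, a <= x <= b -> `|f x| <= M) -> `|intab a b f| <= M * (b - a).
Proof.
move=> lf ab fM; rewrite -intab_cst//; apply: le_trans (norm_intab _ _ lf) _.
by apply: le_intab => //; [exact: lint_norm|exact: lint_cst].
Qed.

Lemma intab_sub a b c d f : lint f -> (forall x, 0 <= f x) ->
  c <= a -> b <= d -> intab a b f <= intab c d f.
Proof.
move=> lf f0 ca bd; have [ab|ba] := leP a b; last first.
  by rewrite intab_gt// intab_ge0.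
rewrite (@intab_split c a d)//; last exact: le_trans bd.
rewrite (@intab_split a b d)//.
by rewrite addrCA lerDl addr_ge0// intab_ge0.
Qed.

Lemma ointxx a f : oint a a f = 0.
Proof. by rewrite /oint lexx intab_xx. Qed.

Lemma ointC a b f : oint a b f = - oint b a f.
Proof.
rewrite /oint; case: (ltgtP a b) => [ab|ba|->]; rewrite ?opprK//.
by rewrite intab_xx oppr0.
Qed.

Lemma oint_split b a c f : lint f -> oint a c f = oint a b f + oint b c f.
Proof.
move=> lf.
have key p q r : p <= q -> q <= r -> oint p r f = oint p q f + oint q r f.
  by move=> pq qr; rewrite /oint pq qr (le_trans pq qr) (intab_split lf pq qr).
have [ab|/ltW ba] := leP a b; have [bc|/ltW cb] := leP b c.
- exact: key.
- have [ac|/ltW ca] := leP a c.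
    by rewrite (key _ _ _ ac cb) (ointC b c) addrK.
  by rewrite (ointC b c) (key _ _ _ ca ab) (ointC c a) opprD opprK addrC addrNK.
- have [ac|/ltW ca] := leP a c.
    by rewrite (ointC a b) (key _ _ _ ba ac) addKr.
  by rewrite (ointC a b) (key _ _ _ bc ca) (ointC a c); lra.
- by rewrite (ointC a c) (key _ _ _ cb ba) opprD addrC -!ointC.
Qed.

Lemma intab_oint a b f : a <= b -> intab a b f = oint a b f.
Proof. by rewrite /oint => ->. Qed.

Lemma ointB a b f g : lint f -> lint g ->
  oint a b (fun x => f x - g x) = oint a b f - oint a b g.
Proof. by move=> lf lg; rewrite /oint !intabB//; case: ifP => // _; rewrite opprD. Qed.

Lemma ointZ a b k f : lint f -> oint a b (fun x => k * f x) = k * oint a b f.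
Proof. by move=> lf; rewrite /oint !intabZ//; case: ifP => // _; rewrite mulrN. Qed.

Lemma eq_oint a b f g : f =1 g -> oint a b f = oint a b g.
Proof. by move=> /funext ->. Qed.

Lemma norm_oint a b f M : lint f -> - M <= a <= M -> - M <= b <= M ->
  `|oint a b f| <= intab (- M) M (fun x => `|f x|).
Proof.
move=> lf /andP[a1 a2] /andP[b1 b2]; rewrite /oint.
have := lint_norm lf => lnf.
by case: ifP => _; rewrite ?normrN; apply: le_trans (norm_intab _ _ lf) _;
  apply: intab_sub.
Qed.

Lemma norm_oint_cst a b f M : lint f -> (forall x, `|x - a| <= `|b - a| -> `|f x| <= M) ->
  `|oint a b f| <= M * `|b - a|.
Proof.
move=> lf fM; rewrite /oint; case: ifPn => [ab|]; last rewrite -ltNge => /ltW ba.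
  have ab0 : `|b - a| = b - a by rewrite ger0_norm ?subr_ge0.
  rewrite ab0 in fM *; apply: intab_bound => // x /andP[ax xb].
  by apply: fM; rewrite ger0_norm ?subr_ge0// lerB.
have ab0 : `|b - a| = a - b by rewrite ler0_norm ?subr_le0 ?opprB.
rewrite normrN ab0 in fM *; apply: intab_bound => // x /andP[ax xb].
by apply: fM; rewrite ler0_norm ?subr_le0// opprB lerB.
Qed.

(** The epsilon-delta form on plain difference quotients, which is where the derivatives in x of
    parameter integrals and of Volterra solutions get estimated. *)
Lemma is_derive_quot f x l :
  (forall e, 0 < e -> exists2 d : R, 0 < d & forall k, k != 0 -> `|k| < d ->
     `|(f (x + k) - f x) / k - l| <= e) -> is_derive x 1 f l.
Proof.
move=> H.
have cv : h^-1 *: (f (h *: 1 + x) - f x) @[h --> (0:R)^'] --> l.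
  apply/cvgrPdist_le => e e0; have [d d0 Hd] := H _ e0.
  near=> k.
  have k0 : k != 0 by near: k; exact: nbhs_dnbhs_neq.
  have kd : `|k| < d.
    by near: k; exact: dnbhs0_lt.
  have -> : k^-1 *: (f (k *: 1 + x) - f x) = (f (x + k) - f x) / k by rewrite /GRing.scale/= mulr1 (addrC k) mulrC.
  by rewrite distrC; exact: Hd.
by apply: DeriveDef; [apply/cvg_ex; exists l|exact/cvg_lim].
Unshelve. all: by end_near. Qed.

Lemma is_derive_oint a f x : continuous f -> is_derive x 1 (fun y => oint a y f) (f x).
Proof.
move=> cf; have lf := lint_cont cf.
apply: is_derive_quot => e e0.
have /cvgrPdist_le/(_ _ e0)/nbhs_ballP[d /= d0 Hd] := cf x.
exists d => // k k0 kd.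
have -> : oint a (x + k) f - oint a x f = oint x (x + k) f.
  by rewrite (oint_split x a (x + k) lf) addrC addKr.
have -> : oint x (x + k) f / k - f x = oint x (x + k) (fun y => f y - f x) / k.
  rewrite (ointB _ _ lf (lint_cst (f x))) mulrBl; congr (_ - _).
  rewrite /oint; case: leP => xk.
    by rewrite intab_cst// addrC addKr mulfK.
  by rewrite intab_cst ?(ltW xk)// opprD addrA subrr sub0r mulrN opprK mulfK.
rewrite normrM normfV ler_pdivrMr ?normr_gt0//.
have -> : `|k| = `|x + k - x| by rewrite addrC addKr.
apply: norm_oint_cst => [|y yx]; first exact: lintB (lint_cst _).
rewrite distrC; apply: Hd; rewrite /ball/= distrC (le_lt_trans yx)//.
by rewrite addrC addKr.
Qed.

Lemma is_derive_cont f (df : R -> R) : (forall x, is_derive x 1 f (df x)) -> continuous f.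
Proof.
move=> H x; have := H x => Hx.
exact/differentiable_continuous/derivable1_diffP/ex_derive.
Qed.

Lemma oint_continuous a f : continuous f -> continuous (fun y => oint a y f).
Proof. by move=> cf; apply: is_derive_cont => x; exact: is_derive_oint. Qed.

End Integrals.

(** * Translation invariance and one-periodic functions *)

Section Periodic.
Variable R : realType.
Notation mu := (@lebesgue_measure R).
Implicit Types (a b c x y : R) (f g h : R -> R).

Lemma measurable_shift c : measurable_fun [set: measurableTypeR R] (fun x : measurableTypeR R => x + c : measurableTypeR R).
Proof.
apply: continuous_measurable_fun => x.
by apply: continuousD; [exact: cvg_id|exact: cst_continuous].
Qed.

Lemma preimage_shift_itv (b0 b1 : bool) c x y :
  (fun z => z + c) @^-1` [set` Interval (BSide b0 x) (BSide b1 y)] =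
  [set` Interval (BSide b0 (x - c)) (BSide b1 (y - c))].
Proof.
by apply/seteqP; split => z /=; rewrite !in_itv/= !(lteifBlDr, lteifBrDr).
Qed.

(** The pushforward under a translation has the right value on half-open intervals, and these
    determine Lebesgue measure. *)
Lemma lebesgue_measure_shift c (A : set (measurableTypeR R)) : measurable A ->
  mu A = pushforward mu (fun x : measurableTypeR R => x + c : measurableTypeR R) A.
Proof.
move: A; have := measurable_shift c => mc.
pose nu : {measure set (measurableTypeR R) -> \bar R} :=
  measure_function_pushforward__canonical__measure_function_Measure mu mc.
apply: (@lebesgue_measure_unique R nu) => X [[x y] _ <-].
rewrite /nu /= /pushforward preimage_shift_itv !lebesgue_measure_itv/= !lte_fin ltrD2r.
by case: ifP => // _; rewrite -!EFinB; congr EFin; ring.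
Qed.

(** Integrability is assumed for the translate and concluded for [f] on the moved segment: this is
    the direction in which periodicity carries it from one period to the next. The change of
    variables [key] for nonnegative functions is applied to the absolute value and to the positive
    and negative parts. *)
Lemma integrable_shift f a b c :
  mu.-integrable `[a, b] (EFin \o (fun x => f (x + c))) ->
  mu.-integrable `[a + c, b + c] (EFin \o f) /\
  intab (a + c) (b + c) f = intab a b (fun x => f (x + c)).
Proof.
set phi := (fun x : measurableTypeR R => x + c : measurableTypeR R).
have mphi : measurable_fun setT phi := measurable_shift c.
have eD : phi @^-1` `[a + c, b + c] = `[a, b]%classic.
  by rewrite preimage_shift_itv !addrK.
move=> ifc; have /integrableP[mfc bfc] := ifc.
have mf : measurable_fun (`[a + c, b + c]%classic : set (measurableTypeR R)) (EFin \o f).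
  have -> : EFin \o f = (EFin \o (fun x => f (x + c))) \o (fun x => x + (- c)).
    by apply/funext => x /=; rewrite addrNK.
  apply: (measurable_comp _ _ mfc) => //.
    by move=> _ [x /= + <-]; rewrite !in_itv/= lerBlDr lerBrDr.
  exact: measurable_funTS (measurable_shift (- c)).
have key (g : measurableTypeR R -> \bar R) :
    measurable_fun (`[a + c, b + c]%classic : set (measurableTypeR R)) g ->
    (forall y, (0 <= g y)%E) ->
    integral mu `[a + c, b + c] g = integral mu `[a, b] (fun x => g (x + c)).
  move=> mg g0; rewrite -eD -(ge0_integral_pushforward mphi)//.
  by apply: eq_measure_integral => A mA _; exact: lebesgue_measure_shift.
split.
  apply/integrableP; split => //; rewrite key//; exact: measurableT_comp.
rewrite /intab /Rintegral; congr fine.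
rewrite integralE [RHS]integralE; congr (_ - _)%E.
  rewrite (key (EFin \o f)^\+%E)//; last exact: measurable_funepos.
  by rewrite unlock.
rewrite (key (EFin \o f)^\-%E)//; last exact: measurable_funeneg.
by rewrite unlock.
Qed.

Lemma oint_shift f a b c : lint f ->
  oint (a + c) (b + c) f = oint a b (fun x => f (x + c)).
Proof.
move=> lf.
have key p q : intab (p + c) (q + c) f = intab p q (fun x => f (x + c)).
  have := @integrable_shift (fun x => f (x + c)) (p + c) (q + c) (- c).
  rewrite !addrK; case=> [|_ ->].
    rewrite (_ : (fun x => _) = f); first exact: lf.
    by apply/funext => x; rewrite addrNK.
  by apply: eq_intab => x _; rewrite addrNK.
by rewrite /oint lerD2r !key.
Qed.

Lemma periodicB1 f : periodic1 f -> forall x, f (x + -1) = f x.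
Proof. by move=> pf x; rewrite -[in RHS](subrK 1 x) (pf (x - 1)). Qed.

Lemma integrable_union f a b c : a <= b -> b <= c ->
  mu.-integrable `[a, b] (EFin \o f) -> mu.-integrable `[b, c] (EFin \o f) ->
  mu.-integrable `[a, c] (EFin \o f).
Proof.
move=> ab bc f1 f2.
have f1' : mu.-integrable `[a, b[ (EFin \o f).
  by apply: integrableS f1 => //; exact: subset_itv_co_cc.
have e : `[a, c]%classic = `[a, b[ `|` `[b, c] by rewrite -itv_bndbnd_setU.
have /integrableP[m1 b1] := f1'; have /integrableP[m2 b2] := f2.
have m : measurable_fun `[a, c] (EFin \o f) by rewrite e; apply/measurable_funU.
apply/integrableP; split => //; rewrite e ge0_integral_setU//.
- exact: lte_add_pinfty.
- by rewrite -e; apply: measurableT_comp.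
- apply/disj_setPS => y [/=]; rewrite 2!in_itv/= => /andP[_ yx] /andP[].
  by rewrite leNgt yx.
Qed.

(** Translation by 1 or -1 carries integrability from one unit segment to its neighbour, and
    finitely many of them cover any segment. *)
Lemma periodic_lint f : periodic1 f -> mu.-integrable `[0, 1] (EFin \o f) -> lint f.
Proof.
move=> pf f01.
have P (n : nat) : mu.-integrable `[n%:R, n%:R + 1] (EFin \o f).
  elim: n => [|n IHn]; first by rewrite add0r.
  rewrite -natr1; apply: (@integrable_shift f n%:R (n%:R + 1) 1 _).1.
  by rewrite (_ : (fun x => _) = f)//; apply/funext => x; rewrite pf.
have N (n : nat) : mu.-integrable `[- n%:R, - n%:R + 1] (EFin \o f).
  elim: n => [|n IHn]; first by rewrite oppr0 add0r.
  rewrite -natr1 opprD (addrAC (- _) (-1)).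
  apply: (@integrable_shift f (- n%:R) (- n%:R + 1) (-1) _).1.
  by rewrite (_ : (fun x => _) = f)//; apply/funext => x; rewrite periodicB1.
have Q (n : nat) : mu.-integrable `[- n%:R, n%:R] (EFin \o f).
  elim: n => [|n IHn].
    rewrite oppr0; apply: integrableS f01 => //.
    by apply: subset_itvl; rewrite bnd_simp.
  have n0 : 0 <= n%:R :> R by [].
  apply: (@integrable_union _ _ (- n%:R)); [by rewrite -natr1; lra|by rewrite -natr1; lra| |].
    by have := N n.+1; rewrite -natr1 opprD addrNK.
  apply: (@integrable_union _ _ (n%:R)) => //; [by lra|by rewrite -natr1; lra|].
  by rewrite -natr1.
move=> a b; set n := (Num.truncn (`|a| + `|b|)).+1.
have hn : `|a| + `|b| < n%:R by exact: truncnS_gt.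
have := ler_norm (- a); have := ler_norm b; rewrite normrN => ? ?.
have := normr_ge0 a; have := normr_ge0 b => ? ?.
by apply: integrableS (Q n) => //; apply: subset_itv; rewrite bnd_simp; lra.
Qed.

(** [K] counts the periods in a segment [-n, n] with n > |M|, so it does not depend on [f]. This
    turns hypotheses in L^2(0, 1) into estimates on every [-M, M]. *)
Lemma periodic_intab_le (M : R) : exists2 K : R, 0 <= K & forall f, periodic1 f -> lint f ->
  (forall x, 0 <= f x) -> forall a b, - M <= a -> b <= M -> intab a b f <= K * intab 0 1 f.
Proof.
have H n : forall f, periodic1 f -> lint f ->
    intab (- n%:R) n%:R f = (2 * n%:R) * intab 0 1 f.
  move=> f pf lf.
  have sh x : oint x (x + 1) f = oint 0 1 f.
    have := oint_shift 0 x 1 lf.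
    rewrite add0r (_ : (fun x => _) = f); last exact/funext.
    by rewrite (oint_split 0 x _ lf) (oint_split 1 0 (x + 1) lf) (ointC x) => ->; ring.
  elim: n => [|n IHn]; first by rewrite oppr0 intab_xx mulr0 mul0r.
  have n0 : 0 <= n%:R :> R by [].
  rewrite -natr1 (@intab_split _ _ (- n%:R))//; [|lra|lra].
  rewrite (@intab_split _ _ n%:R (n%:R + 1))//; [|lra|lra].
  rewrite IHn (intab_oint (a := n%:R)); last lra.
  rewrite sh (intab_oint (a := - (n%:R + 1))); last lra.
  have := sh (- (n%:R + 1)); rewrite opprD addrNK => ->.
  rewrite -intab_oint//; ring.
set n := (Num.truncn `|M|).+1; exists (2 * n%:R); first by rewrite mulr_ge0.
have hn : `|M| < n%:R by exact: truncnS_gt.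
have := ler_norm M => ?.
move=> f pf lf f0 a b Ma bM; rewrite -H//; apply: intab_sub => //; lra.
Qed.

End Periodic.

(** * Joint continuity in time and space *)

Section JointContinuity.
Variable R : realType.
Notation mu := (@lebesgue_measure R).
Implicit Types (a b c d e t x y M : R) (f g h : R -> R -> R).

(* A variant rather than a definition, to keep [done] from unfolding it. *)
Variant jcont f : Prop := JCont of continuous (fun p : R * R => f p.1 p.2).

Lemma jcontP f : jcont f <-> forall t0 x0 e, 0 < e -> exists2 d : R, 0 < d &
  forall t x, `|t - t0| < d -> `|x - x0| < d -> `|f t x - f t0 x0| < e.
Proof.
split=> [[cf] t0 x0 e e0|H]; last split=> -[t0 x0].
  have /cvgrPdist_lt/(_ _ e0)/nbhs_ballP[d /= d0 Hd] := cf (t0, x0).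
  exists d => // t x td xd; rewrite distrC; apply: (Hd (t, x)).
  by split; rewrite /ball/= distrC.
apply/cvgrPdist_lt => e e0; have [d d0 Hd] := H t0 x0 e e0.
exists (ball t0 d, ball x0 d); first by split; exact: nbhsx_ballx.
move=> -[t x] [/= td xd].
by rewrite distrC; apply: Hd; rewrite distrC.
Qed.

Lemma jcont_swap f : jcont f -> jcont (fun x t => f t x).
Proof.
move=> /jcontP cf; apply/jcontP => x0 t0 e e0.
by have [d d0 Hd] := cf t0 x0 e e0; exists d => // x t xd td; exact: Hd.
Qed.

Lemma jcont2 f t : jcont f -> continuous (f t).
Proof.
move=> /jcontP cf x0; apply/cvgrPdist_lt => e e0.
have [d d0 Hd] := cf t x0 e e0.
apply/nbhs_ballP; exists d => //= x xd; rewrite distrC; apply: Hd.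
  by rewrite subrr normr0.
by rewrite distrC.
Qed.

Lemma jcont1 f x : jcont f -> continuous (f ^~ x).
Proof. by move=> /jcont_swap/(jcont2 (f := fun x t => f t x)). Qed.

Lemma jcont_cst k : jcont (fun _ _ => k).
Proof. by split=> p; exact: cst_continuous. Qed.

Lemma jcont_time (h : R -> R) : continuous h -> jcont (fun t _ => h t).
Proof.
move=> ch; split=> p; apply: (@continuous_comp _ _ _ fst h); last exact: ch.
exact: cvg_fst.
Qed.

Lemma jcont_space (h : R -> R) : continuous h -> jcont (fun _ x => h x).
Proof. by move=> /jcont_time/jcont_swap. Qed.

Lemma jcontD f g : jcont f -> jcont g -> jcont (fun t x => f t x + g t x).
Proof. by move=> [cf] [cg]; split=> p; apply: continuousD; [exact: cf|exact: cg]. Qed.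

Lemma jcontM f g : jcont f -> jcont g -> jcont (fun t x => f t x * g t x).
Proof. by move=> [cf] [cg]; split=> p; apply: continuousM; [exact: cf|exact: cg]. Qed.

Lemma jcontB f g : jcont f -> jcont g -> jcont (fun t x => f t x - g t x).
Proof. by move=> [cf] [cg]; split=> p; apply: continuousB; [exact: cf|exact: cg]. Qed.

Lemma jcont_exp f : jcont f -> jcont (fun t x => expR (f t x)).
Proof.
move=> [cf]; split=> p; apply: (@continuous_comp _ _ _ (fun p : R * R => f p.1 p.2) expR).
  exact: cf.
exact: continuous_expR.
Qed.

(** Compactness of [-M, M] makes continuity in t uniform in x; this is the tube lemma in the form of
    near coverings. *)
Lemma jcont_tube f t0 M e : jcont f -> 0 < e -> exists2 d : R, 0 < d &
  forall t x, `|t - t0| < d -> `|x| <= M -> `|f t x - f t0 x| < e.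
Proof.
move=> /jcontP cf e0.
have : \forall t \near t0, `[- M, M]%classic `<=` (fun x => `|f t x - f t0 x| < e).
  have /compact_near_coveringP nc := @segment_compact R (- M) M.
  apply: (nc R (nbhs t0) (fun t x => `|f t x - f t0 x| < e)) => x0 _; have e2 : 0 < e / 2 by rewrite divr_gt0.
  have [d d0 Hd] := cf t0 x0 _ e2.
  exists (ball x0 d, ball t0 d).
    by split; apply: nbhsx_ballx.
  move=> [x t] [/= xd td].
  rewrite -(subrKA (f t0 x0)) (splitr e).
  apply: le_lt_trans (ler_normD _ _) _; apply: ltrD.
    by apply: Hd; rewrite distrC.
  by rewrite distrC; apply: Hd; rewrite ?subrr ?normr0// distrC.
move=> /nbhs_ballP[d /= d0 Hd]; exists d => // t x td xM.
apply: Hd; first by rewrite /ball/= distrC.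
by rewrite /= in_itv/= -ler_norml.
Qed.

Lemma jcont_bounded f T M : jcont f -> exists2 K : R, 0 < K &
  forall t x, `|t| <= T -> `|x| <= M -> `|f t x| <= K.
Proof.
move=> [cf].
have [T0|T0] := ltP T 0.
  exists 1 => // t x tT; have := le_lt_trans (le_trans (normr_ge0 _) tT) T0.
  by rewrite ltxx.
have [M0|M0] := ltP M 0.
  exists 1 => // t x _ tT; have := le_lt_trans (le_trans (normr_ge0 _) tT) M0.
  by rewrite ltxx.
have := compact_setX (@segment_compact R (- T) T) (@segment_compact R (- M) M).
move=> cK.
have [||p _ Hp] := @compact_EVT_max _ R (fun p : R * R => `|f p.1 p.2|) _ _ cK.
- by exists (0, 0); split; rewrite /= in_itv/= ?oppr_le0 ?T0 ?M0.
- apply: continuous_subspaceT => p.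
  apply: (@continuous_comp (R * R)%type R R (fun p => f p.1 p.2) (fun z => `|z|)).
    exact: cf.
  exact: norm_continuous.
exists (`|f p.1 p.2| + 1); first by rewrite ltr_wpDl.
move=> t x tT xM; rewrite (le_trans (Hp (t, x) _)) ?lerDl//.
by rewrite inE; split; rewrite /= in_itv/= -ler_norml.
Qed.

Lemma jcont_lint f t : jcont f -> lint (f t).
Proof. by move=> cf; apply: lint_cont; exact: jcont2. Qed.

End JointContinuity.

(** * Continuous curves in local L^1 and their primitives *)

Section L1Curves.
Variable R : realType.
Notation mu := (@lebesgue_measure R).
Implicit Types (a b c d e t x y M : R) (f g h : R -> R -> R).

(** Continuity of t |-> g(t) in L^1_loc of the line. Products of two L^2-continuous curves are of
    this kind, and it suffices for a jointly continuous primitive in x. *)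
Definition L1_curve g := (forall t, lint (g t)) /\
  forall t0 M e, 0 < e -> exists2 d : R, 0 < d & forall t, `|t - t0| < d ->
    intab (- M) M (fun x => `|g t x - g t0 x|) <= e.

Lemma jcont_L1_curve f : jcont f -> L1_curve f.
Proof.
move=> cf; split=> [t|t0 M e e0]; first exact: jcont_lint.
have [M0|M0] := ltP M 0.
  by exists 1 => // t _; rewrite intab_gt ?ltW//; lra.
have e1 : 0 < e / (2 * M + 1) by rewrite divr_gt0//; lra.
have [d d0 Hd] := jcont_tube t0 M cf e1.
exists d => // t td.
have l1 : lint (fun x => `|f t x - f t0 x|).
  by apply: lint_norm; apply: lintB; exact: jcont_lint.
apply: (@le_trans _ _ (intab (- M) M (fun=> e / (2 * M + 1)))).
  apply: le_intab => //; first exact: lint_cst.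
  by move=> x xM; apply/ltW/Hd => //; rewrite ler_norml.
rewrite intab_cst; last lra.
rewrite mulrAC ler_pdivrMr; last lra.
by rewrite ler_wpM2l ?(ltW e0)//; lra.
Qed.

Lemma L1_curveD f g : L1_curve f -> L1_curve g -> L1_curve (fun t x => f t x + g t x).
Proof.
move=> [lf cf] [lg cg]; split=> [t|t0 M e e0]; first exact: lintD.
have e2 : 0 < e / 2 by rewrite divr_gt0.
have [d1 d10 H1] := cf t0 M _ e2; have [d2 d20 H2] := cg t0 M _ e2.
exists (Num.min d1 d2) => [|t]; first by rewrite lt_min d10.
rewrite lt_min => /andP[t1 t2].
have lnf : lint (fun x => `|f t x - f t0 x|) by apply: lint_norm; exact: lintB.
have lng : lint (fun x => `|g t x - g t0 x|) by apply: lint_norm; exact: lintB.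
rewrite (splitr e); apply: le_trans (lerD (H1 _ t1) (H2 _ t2)).
rewrite -intabD//; apply: le_intab.
- by apply: lint_norm; apply: lintB; exact: lintD.
- exact: lintD.
- by move=> x _; rewrite opprD addrACA; exact: ler_normD.
Qed.

Lemma L1_curve_mulc f g : jcont f -> L1_curve g -> L1_curve (fun t x => f t x * g t x).
Proof.
move=> cf [lg cg].
have lfg t s : lint (fun x => f t x * g s x).
  by apply: lint_mulc => //; exact: jcont2.
split=> [t|t0 M e e0]; first exact: lfg.
have [K K0 HK] := jcont_bounded (`|t0| + 1) M cf.
set N := intab (- M) M (fun x => `|g t0 x|).
have N0 : 0 <= N by apply: intab_ge0.
have e2' : 0 < e / 2 by rewrite divr_gt0.
(* In f g - f0 g0 = f (g - g0) + (f - f0) g0 each term gets e/2: the factor f costs [K], the mass of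
   g0 costs [N], and the 1 added to [N] covers the case N = 0. *)
have e1 : 0 < e / (2 * K) by rewrite divr_gt0// mulr_gt0.
have e2 : 0 < e / (2 * (N + 1)) by rewrite divr_gt0// mulr_gt0// ltr_wpDl.
have [d1 d10 H1] := cg t0 M _ e1.
have [d2 d20 H2] := jcont_tube t0 M cf e2.
exists (Num.min 1 (Num.min d1 d2)) => [|t].
  by rewrite !lt_min d10 d20 ltr01.
rewrite !lt_min => /andP[t1 /andP[td1 td2]].
have tT : `|t| <= `|t0| + 1.
  by rewrite -(subrK t0 t) (le_trans (ler_normD _ _))// addrC lerD// ltW.
have lng : lint (fun x => `|g t x - g t0 x|) by apply: lint_norm; exact: lintB.
have lng0 : lint (fun x => `|g t0 x|) by apply: lint_norm.
apply: (@le_trans _ _ (intab (- M) M (fun x =>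
    K * `|g t x - g t0 x| + e / (2 * (N + 1)) * `|g t0 x|))).
  apply: le_intab.
  - by apply: lint_norm; apply: lintB.
  - by apply: lintD; exact: lintZ.
  - move=> x; rewrite -ler_norml => xM.
    rewrite (_ : _ - _ = f t x * (g t x - g t0 x) + (f t x - f t0 x) * g t0 x); last by ring.
    apply: le_trans (ler_normD _ _) _; rewrite !normrM; apply: lerD; apply: ler_wpM2r => //.
      exact: HK.
    by apply/ltW/H2.
rewrite intabD; [|exact: lintZ|exact: lintZ].
rewrite !intabZ// -/N (splitr e); apply: lerD.
  apply: le_trans (ler_wpM2l (ltW K0) (H1 _ td1)) _.
  by rewrite invfM mulrCA (mulrCA K) mulfV ?mulr1// gt_eqF.
have N1 : 0 < N + 1 by rewrite ltr_wpDl.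
rewrite (_ : _ * N = e / 2 * (N / (N + 1))); last by field; rewrite gt_eqF.
by rewrite ler_piMr ?(ltW e2')// ler_pdivrMr ?mul1r ?lerDl.
Qed.

(** Absolute continuity of the Lebesgue integral, for [f] extended by zero outside the segment. It
    gives both the continuity of primitives in x and the absolute continuity of the flow. *)
Lemma lint_small (f : R -> R) a b e : lint f -> 0 < e -> exists2 d : R, 0 < d &
  forall A : set (measurableTypeR R), measurable A -> A `<=` `[a, b] -> (mu A < d%:E)%E ->
    Rintegral mu A (fun x => `|f x|) < e.
Proof.
move=> lf e0.
have intg : mu.-integrable setT (EFin \o (f \_ `[a, b])).
  rewrite -restrict_EFin.
  by apply: (@integrable_mkcond _ _ _ mu (`[a, b]%classic : set (measurableTypeR R)) _ _).1.
have [d [d0 Hd]] := integral_normr_continuous intg e0.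
exists d => // A mA Aab Ad; apply: le_lt_trans (Hd A mA Ad).
rewrite le_eqVlt; apply/orP; left; apply/eqP; apply: eq_Rintegral => x.
by rewrite inE => Ax; rewrite patchE mem_set//; exact: Aab.
Qed.

(** A change of t is paid by the L^1 distance of f(t) and f(t0), uniformly in x; a change of x only
    involves the fixed function f(t0), whose integral over short intervals is small. *)
Lemma L1_curve_oint f : L1_curve f -> jcont (fun t x => oint 0 x (f t)).
Proof.
move=> [lf cf]; apply/jcontP => t0 x0 e e0.
have e2 : 0 < e / 2 by rewrite divr_gt0.
pose M : R := `|x0| + 1.
have [d1 d10 H1] := cf t0 M _ e2.
have [d2 d20 H2] : exists2 d : R, 0 < d & forall x, `|x - x0| < d -> `|oint x0 x (f t0)| < e / 2.
  have [d d0 Hd] := lint_small (x0 - 1) (x0 + 1) (lf t0) e2.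
  have sm (a b : R) : x0 - 1 <= a -> a <= b -> b <= x0 + 1 -> b - a < d ->
      `|intab a b (f t0)| < e / 2.
    move=> x1a ab bx1 bad; apply: le_lt_trans (norm_intab _ _ (lf t0)) _.
    apply: Hd => //; first by apply: subset_itv; rewrite bnd_simp.
    rewrite lebesgue_measure_itv/= lte_fin; case: ifP => _; last by rewrite lte_fin.
    by rewrite -EFinB lte_fin.
  exists (Num.min 1 d) => [|x]; first by rewrite lt_min ltr01.
  rewrite lt_min => /andP[/ltr_normlP[? ?] /ltr_normlP[? ?]].
  rewrite /oint; case: ifPn => [?|]; first by apply: sm; lra.
  by rewrite -ltNge normrN => ?; apply: sm; lra.
exists (Num.min 1 (Num.min d1 d2)) => [|t x]; first by rewrite !lt_min ltr01 d10.
rewrite !lt_min => /andP[_ /andP[td1 _]] /andP[x1 /andP[_ xd2]].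
have -> : oint 0 x (f t) - oint 0 x0 (f t0) =
    oint 0 x (fun y => f t y - f t0 y) + oint x0 x (f t0).
  by rewrite ointB// (oint_split x0 0 x (lf t0)); ring.
rewrite (splitr e); apply: le_lt_trans (ler_normD _ _) _.
apply: ler_ltD; last exact: H2.
apply: le_trans (H1 _ td1); apply: norm_oint; first exact: lintB.
  by rewrite -ler_norml normr0 /M addr_ge0.
rewrite -ler_norml -(subrK x0 x) (le_trans (ler_normD _ _))// addrC lerD//.
exact: ltW.
Qed.

End L1Curves.

(** * Time primitives in an exponentially weighted norm *)

Section Volterra.
Variable R : realType.
Implicit Types (a b c d e t s x y K L M T C : R) (f g h : R -> R).

(** With [intab] in place of [oint] the primitive vanishes for t < 0, so an integral equation on t
    >= 0 extends to all real t. *)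
Definition prim f t := intab 0 t f.

Lemma prim_oint f t : prim f t = oint 0 (Num.max 0 t) f.
Proof.
rewrite /prim /oint le_max lexx/=; case: leP => // t0.
by rewrite intab_xx intab_gt.
Qed.

Lemma prim_lt0 f t : t < 0 -> prim f t = 0.
Proof. exact: intab_gt. Qed.

Lemma prim_cont f : continuous f -> continuous (prim f).
Proof.
move=> cf t; rewrite (_ : prim f = oint 0 ^~ f \o Num.max 0); last first.
  by apply/funext => s; rewrite prim_oint.
apply: continuous_comp; last exact: oint_continuous.
apply: (@continuous_max _ _ (cst 0) idfun); [exact: cst_continuous|exact: cvg_id].
Qed.

Lemma oint_expR L t : L != 0 -> oint 0 t (fun s => expR (L * s)) = (expR (L * t) - 1) / L.
Proof.
move=> L0.
have cE : continuous (fun s => expR (L * s)).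
  move=> s; apply: (@continuous_comp _ _ _ (fun s => L * s) expR); last exact: continuous_expR.
  exact: mulrl_continuous.
pose F s := oint 0 s (fun s => expR (L * s)) - expR (L * s) / L.
have dF s : is_derive s 1 F 0.
  have := is_derive_oint 0 s cE => ?.
  apply: is_derive_eq.
  by rewrite /GRing.scale/=; field.
have := is_derive_0_is_cst t 0 dF.
rewrite /F ointxx mulr0 expR0 => /eqP; rewrite subr_eq => /eqP ->.
by field.
Qed.

(** The integral of C e^{Ls} over [0, t] is C/L (e^{Lt} - 1): each primitive gains a factor 1/L in
    the weighted norm. *)
Lemma prim_weight f C L T : 0 < L -> lint f ->
  (forall s, 0 <= s <= T -> `|f s| <= C * expR (L * s)) ->
  forall t, 0 <= t <= T -> `|prim f t| <= C / L * expR (L * t).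
Proof.
move=> L0 lf fC t /andP[t0 tT].
have C0 : 0 <= C.
  have := fC 0; rewrite lexx (le_trans t0 tT) mulr0 expR0 mulr1 => /(_ isT).
  exact: le_trans.
have lE : lint (fun s => expR (L * s)).
  apply: lint_cont => s; apply: (@continuous_comp _ _ _ (fun s => L * s) expR).
    exact: mulrl_continuous.
  exact: continuous_expR.
apply: le_trans (norm_intab _ _ lf) _.
apply: (@le_trans _ _ (intab 0 t (fun s => C * expR (L * s)))).
  apply: le_intab; [exact: lint_norm|exact: lintZ|move=> s /andP[s0 st]].
  by apply: fC; rewrite s0 (le_trans st).
rewrite intabZ// intab_oint// oint_expR ?gt_eqF// mulrA (mulrAC C).
by rewrite ler_wpM2l ?divr_ge0 ?(ltW L0)//; lra.
Qed.

(* For [2 * K <= L ^+ 2] the double primitive halves the norm weighted by e^{-Lt}. *)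
Lemma prim2_weight (A u : R -> R) K C L T : 0 < L -> 2 * K <= L ^+ 2 ->
  continuous A -> continuous u ->
  (forall s, 0 <= s <= T -> `|A s| <= K) ->
  (forall s, 0 <= s <= T -> `|u s| <= C * expR (L * s)) ->
  forall t, 0 <= t <= T -> `|prim (prim (fun s => A s * u s)) t| <= C / 2 * expR (L * t).
Proof.
move=> L0 KL cA cu AK uC t tT.
have cAu : continuous (fun s => A s * u s).
  by move=> s; apply: continuousM; [exact: cA|exact: cu].
have t0T : 0 <= (0 : R) <= T by rewrite lexx/=; case/andP: tT => /le_trans; apply.
have K0 : 0 <= K by exact: le_trans (AK 0 t0T).
have C0 : 0 <= C.
  by have := uC 0 t0T; rewrite mulr0 expR0 mulr1; exact: le_trans.
have H1 s : 0 <= s <= T -> `|A s * u s| <= K * C * expR (L * s).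
  move=> sT; rewrite normrM -mulrA ler_pM//; [exact: AK|exact: uC].
have H2 := prim_weight L0 (lint_cont cAu) H1.
have H3 := prim_weight L0 (lint_cont (prim_cont cAu)) H2 tT.
apply: le_trans H3 _; rewrite ler_wpM2r ?expR_ge0//.
rewrite ler_pdivrMr// ler_pdivrMr// -mulrA -expr2 mulrAC (mulrC K).
rewrite -mulrA ler_wpM2l//; lra.
Qed.

(** The maximum C of |u(t)| e^{-Lt} on [0, T] is attained at some m. At m the double primitive is at
    most half of C e^{Lm} and is absorbed on the left; since e^{Lm} >= 1, this leaves C <= 2 c0. *)
Lemma volterra_gronwall (A u : R -> R) K c0 L T : 0 < L -> 2 * K <= L ^+ 2 -> 0 <= T ->
  continuous A -> continuous u ->
  (forall s, 0 <= s <= T -> `|A s| <= K) ->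
  (forall t, 0 <= t <= T -> `|u t| <= c0 + `|prim (prim (fun s => A s * u s)) t|) ->
  forall t, 0 <= t <= T -> `|u t| <= 2 * c0 * expR (L * t).
Proof.
move=> L0 KL T0 cA cu AK uH.
have cw : continuous (fun t => `|u t| * expR (- (L * t))).
  move=> t; apply: (@continuousM R R (fun t => `|u t|) (fun t => expR (- (L * t)))).

    by apply: (@continuous_comp _ _ _ u (fun z => `|z|)); [exact: cu|exact: norm_continuous].
  apply: (@continuous_comp _ _ _ (fun s => - (L * s)) expR); last exact: continuous_expR.
  by apply: continuousN; exact: mulrl_continuous.
have [m + Hm] := EVT_max T0 (continuous_subspaceT cw).
rewrite in_itv/= => mT; set C := `|u m| * expR (- (L * m)) in Hm.
have uC s : 0 <= s <= T -> `|u s| <= C * expR (L * s).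
  move=> sT; have := Hm s; rewrite in_itv/= => /(_ sT).
  by rewrite expRN ler_pdivrMr ?expR_gt0.
have := uH m mT; have := prim2_weight L0 KL cA cu AK uC mT.
have -> : `|u m| = C * expR (L * m) by rewrite /C expRN divfK// gt_eqF// expR_gt0.
move=> h1 h2.
have em1 : 1 <= expR (L * m).
  by rewrite -expR0 ler_expR mulr_ge0//; [exact: ltW|case/andP: mT].
have c00 : 0 <= c0.
  have := le_trans h2 (lerD (lexx _) h1) => h3.
  have : C / 2 * expR (L * m) <= c0 by lra.
  by apply: le_trans; rewrite mulr_ge0 ?expR_ge0// divr_ge0// mulr_ge0 ?expR_ge0.
have Cc0 : C <= 2 * c0.
  have : C / 2 * expR (L * m) <= c0 by lra.
  move=> h; have : C / 2 * 1 <= c0.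
    by apply: le_trans h; rewrite ler_wpM2l// divr_ge0// mulr_ge0 ?expR_ge0.
  lra.
move=> t tT; apply: le_trans (uC t tT) _.
by rewrite ler_wpM2r// expR_ge0.
Qed.

Lemma half_small C e : 0 < e -> exists n, C / 2 ^+ n < e.
Proof.
move=> e0; set n := (Num.truncn (`|C| / e)).+1; exists n.
rewrite ltr_pdivrMr ?exprn_gt0// mulrC -ltr_pdivrMr//.
apply: (@le_lt_trans _ _ (`|C| / e)); first by rewrite ler_wpM2r ?invr_ge0 ?(ltW e0)// ler_norm.
apply: (@lt_trans _ _ n%:R); first exact: truncnS_gt.
by rewrite -natrX ltr_nat ltn_expl.
Qed.

(* The limit is independent of [C]: for a family [v] depending on parameters, one limit
   function serves every local bound. *)
Lemma half_cauchy (v : nat -> R) : exists l, forall C,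
  (forall n, `|v n.+1 - v n| <= C / 2 ^+ n) -> forall n, `|l - v n| <= 2 * C / 2 ^+ n.
Proof.
have key C : (forall n, `|v n.+1 - v n| <= C / 2 ^+ n) ->
    exists l, forall n, `|l - v n| <= 2 * C / 2 ^+ n.
  move=> vC.
  have step n : 2 * C / 2 ^+ n = C / 2 ^+ n + 2 * C / 2 ^+ n.+1.
    by rewrite exprS; field; rewrite expf_neq0.
  (* The increments from index n on sum to at most 2C/2^n, so the intervals [a n, b n] are nested;
     the supremum of the left ends lies in all of them. *)
  pose a n := v n - 2 * C / 2 ^+ n; pose b n := v n + 2 * C / 2 ^+ n.
  have C0 : 0 <= C by have := vC 0; rewrite expr0 divr1; exact: le_trans.
  have ndA : {homo a : m n / (m <= n)%N >-> m <= n}.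
    apply: homo_leq => //; first by move=> ? ? ?; exact: le_trans.
    move=> n; rewrite /a (step n); have := vC n; rewrite ler_norml => /andP[? ?]; lra.
  have niB : {homo b : m n / (m <= n)%N >-> n <= m}.
    apply: (homo_leq (r := fun x y => y <= x)) => //.
      by move=> ? ? ? h1 h2; exact: le_trans h2 h1.
    move=> n; rewrite /b (step n); have := vC n; rewrite ler_norml => /andP[? ?]; lra.
  have ab m n : a m <= b n.
    apply: (@le_trans _ _ (a (maxn m n))); first by apply: ndA; exact: leq_maxl.
    apply: (@le_trans _ _ (b (maxn m n))); last by apply: niB; exact: leq_maxr.
    have h : 0 <= 2 * C / 2 ^+ maxn m n by rewrite divr_ge0 ?exprn_ge0// mulr_ge0.
    by rewrite /a /b; lra.
  exists (sup (range a)) => n.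
  have hs : has_sup (range a).
    by split; [exists (a 0); exists 0%N|exists (b 0) => _ [m _ <-]].
  have h1 : a n <= sup (range a) by apply: ub_le_sup; [case: hs|exists n].
  have h2 : sup (range a) <= b n.
    by apply: ge_sup; [case: hs|move=> _ [m _ <-]].
  by rewrite ler_norml; move: h1 h2; rewrite /a /b => *; apply/andP; split; lra.
have [[C vC]|none] := pselect (exists C, forall n, `|v n.+1 - v n| <= C / 2 ^+ n); last first.
  (* Without any geometric bound the claim is vacuous and 0 is an arbitrary value. *)
  by exists 0 => C vC; exfalso; apply: none; exists C.
have [l Hl] := key C vC; exists l => C' vC' n.
have [l' Hl'] := key C' vC'.
suff -> : l = l' by exact: Hl'.
apply/eqP; rewrite -subr_eq0 -normr_eq0; apply/negPn/negP => ll'.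
have lp : 0 < `|l - l'| by rewrite lt0r ll' /=.
have [m Hm] := half_small (2 * C + 2 * C') lp.
move: Hm; apply/negP; rewrite -leNgt -(subrKA (v m)) mulrDl.
apply: le_trans (ler_normD _ _) _; apply: lerD; first exact: Hl.
by rewrite distrC; exact: Hl'.
Qed.

End Volterra.

(** * Volterra equations with a space parameter: existence *)

Section VolterraParameter.
Variable R : realType.
Implicit Types (d e t s x y K L M T C : R) (f g h A c phi : R -> R -> R).

Definition vprim f t x := prim (f ^~ x) t.
Definition vop A phi := vprim (vprim (fun t x => A t x * phi t x)).
(** With c = 1 + t b(x) and t >= 0 this is the integrated form of phi_tt = A phi, phi(0) = 1,
    phi_t(0) = b; for t < 0 it says phi = c. *)
Definition volterra A c phi := forall t x, phi t x = c t x + vop A phi t x.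

Lemma dist_max0 t s : `|Num.max 0 t - Num.max 0 s| <= `|t - s|.
Proof.
have h1 := ler_norm (t - s); have h2 := ler_norm (s - t).
rewrite distrC in h2.
by case: (leP 0 t) => t0; case: (leP 0 s) => s0;
  rewrite ler_norml; apply/andP; split; lra.
Qed.

Lemma dist_third (a b a' b' k e : R) : k < e / 3 -> `|a - b| <= k -> `|a' - b'| <= k ->
  `|b - b'| < e / 3 -> `|a - a'| < e.
Proof.
move=> ke /ler_normlP[? ?] /ler_normlP[? ?] /ltr_normlP[? ?].
by apply/ltr_normlP; split; lra.
Qed.

Lemma ler_half (a : R) : 0 <= a -> a / 2 <= a.
Proof. by move=> a0; lra. Qed.

(** Admits the rate L = 2K + 1 in the weighted estimates. *)
Lemma double_le_sqr K : 0 < K -> 2 * K <= (2 * K + 1) ^+ 2.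
Proof. by move=> K0; nra. Qed.

Lemma jcont_clip f : jcont f -> jcont (fun t x => f (Num.max 0 t) x).
Proof.
move=> /jcontP cf; apply/jcontP => t0 x0 e e0.
have [d d0 Hd] := cf (Num.max 0 t0) x0 e e0; exists d => // t x td xd.
by apply: Hd => //; exact: le_lt_trans (dist_max0 _ _) td.
Qed.

(** Joint continuity is known for primitives in the second variable; exchanging the variables and
    clipping the upper limit at 0 gives it for primitives in time. *)
Lemma jcont_vprim f : jcont f -> jcont (vprim f).
Proof.
move=> cf.
have := jcont_clip (jcont_swap (L1_curve_oint (jcont_L1_curve (jcont_swap cf)))).
congr jcont; apply/funext => t; apply/funext => x.
by rewrite /vprim prim_oint.
Qed.

Lemma jcont_vop A phi : jcont A -> jcont phi -> jcont (vop A phi).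
Proof. by move=> cA cp; do 2 apply: jcont_vprim; exact: jcontM. Qed.

Lemma vop_lt0 A phi t x : t < 0 -> vop A phi t x = 0.
Proof. exact: prim_lt0. Qed.

Lemma vopB A phi psi : jcont A -> jcont phi -> jcont psi -> forall t x,
  vop A phi t x - vop A psi t x = vop A (fun t x => phi t x - psi t x) t x.
Proof.
move=> cA cp cq t x; have cAp := jcontM cA cp; have cAq := jcontM cA cq.
rewrite /vop /vprim /prim -intabB; last 2 first.
- by apply: lint_cont; exact: (jcont1 (jcont_vprim cAp)).
- by apply: lint_cont; exact: (jcont1 (jcont_vprim cAq)).
apply: eq_intab => s _; rewrite -intabB; last 2 first.
- by apply: lint_cont; exact: (jcont1 cAp).
- by apply: lint_cont; exact: (jcont1 cAq).
by apply: eq_intab => r _; rewrite mulrBr.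
Qed.

Lemma vop_weight A u K C L T M : 0 < L -> 2 * K <= L ^+ 2 ->
  jcont A -> jcont u ->
  (forall t x, `|t| <= T -> `|x| <= M -> `|A t x| <= K) ->
  (forall t x, 0 <= t <= T -> `|x| <= M -> `|u t x| <= C * expR (L * t)) ->
  forall t x, 0 <= t <= T -> `|x| <= M -> `|vop A u t x| <= C / 2 * expR (L * t).
Proof.
move=> L0 KL cA cu AK uC t x tT xM.
apply: (prim2_weight L0 KL (jcont1 cA) (jcont1 cu) _ _ tT) => s sT.
  by apply: AK => //; rewrite ger0_norm; case/andP: sT.
exact: uC.
Qed.

Local Opaque vop.

(** Picard iteration starting from c. On a box [0, T] x [-M, M] consecutive iterates halve their
    weighted distance, so convergence is locally uniform and the limit jointly continuous, with no
    smallness of T. *)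
Lemma volterra_exists A c : jcont A -> jcont c -> exists2 phi, jcont phi & volterra A c phi.
Proof.
move=> cA cc.
pose u n := iter n (fun phi t x => c t x + vop A phi t x) c.
have cu n : jcont (u n).
  by elim: n => [//|n IHn]; apply: jcontD => //; exact: jcont_vop.
have u0 t x : u 0%N t x = c t x by [].
have uS n t x : u n.+1 t x = c t x + vop A (u n) t x by [].
clearbody u.
(* The limit is chosen once for each point, before any box is fixed; each box later supplies its own
   constant for the same limit. *)
have /choice[p Hp] : forall q : R * R, exists l, forall C,
    (forall n, `|u n.+1 q.1 q.2 - u n q.1 q.2| <= C / 2 ^+ n) ->
    forall n, `|l - u n q.1 q.2| <= 2 * C / 2 ^+ n.
  by move=> q; exact: half_cauchy.
pose phi t x := p (t, x).
have rate T M : 0 <= T -> exists2 C : R, 0 <= C & forall n t x, t <= T -> `|x| <= M ->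
    `|phi t x - u n t x| <= C / 2 ^+ n.
  move=> T0.
  have [K K0 HK] := jcont_bounded T M cA.
  have [C C0 HC] := jcont_bounded T M (jcont_vop cA cc).
  pose L := 2 * K + 1.
  have L0 : 0 < L by rewrite /L; lra.
  have KL : 2 * K <= L ^+ 2 by exact: double_le_sqr.
  have dec n t x : 0 <= t <= T -> `|x| <= M ->
      `|u n.+1 t x - u n t x| <= C / 2 ^+ n * expR (L * t).
    elim: n t x => [|n IHn] t x tT xM.
      have e0 : vop A (u 0%N) = vop A c by congr vop; apply/funext => s; apply/funext.
      rewrite uS u0 e0 addrC addKr expr0 divr1 (le_trans (HC _ _ _ xM))//.
        by rewrite ger0_norm; case/andP: tT.
      rewrite ler_peMr ?(ltW C0)// -expR0 ler_expR mulr_ge0 ?(ltW L0)//.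
      by case/andP: tT.
    rewrite (_ : _ - _ = vop A (fun t x => u n.+1 t x - u n t x) t x); last first.
      by rewrite -(vopB cA (cu n.+1) (cu n)) !uS; ring.
    have := vop_weight L0 KL cA (jcontB (cu n.+1) (cu n)) HK IHn tT xM.
    by rewrite exprSr invfM mulrA.
  exists (2 * (C * expR (L * T))) => [|n t x tT xM].
    by rewrite !mulr_ge0 ?expR_ge0// ltW.
  apply: (Hp (t, x)) => {}n /=.
  have [t0|t0] := leP 0 t.
    apply: le_trans (dec n t x _ xM) _; first by rewrite t0.
    rewrite mulrAC ler_wpM2r ?invr_ge0 ?exprn_ge0// ler_wpM2l ?(ltW C0)//.
    by rewrite ler_expR ler_wpM2l ?(ltW L0).
  rewrite (_ : _ - _ = 0) ?normr0 ?divr_ge0 ?exprn_ge0 ?mulr_ge0 ?expR_ge0 ?(ltW C0)//.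
  by case: n => [|n]; rewrite !uS ?u0 !vop_lt0//; ring.
have cphi : jcont phi.
  apply/jcontP => t0 x0 e e0.
  have T0 : 0 <= `|t0| + 1 by rewrite addr_ge0.
  have [C _ HC] := rate (`|t0| + 1) (`|x0| + 1) T0.
  have e3 : 0 < e / 3 by rewrite divr_gt0.
  have [n Hn] := half_small C e3.
  have /jcontP/(_ t0 x0 _ e3)[d d0 Hd] := cu n.
  exists (Num.min 1 d) => [|t x]; first by rewrite lt_min ltr01.
  rewrite !lt_min => /andP[t1 td] /andP[x1 xd].
  have b (z z0 : R) : `|z - z0| < 1 -> `|z| <= `|z0| + 1.
    move=> zz; rewrite -(subrK z0 z) (le_trans (ler_normD _ _))// addrC lerD//.
    exact: ltW.
  have h1 := HC n t x (le_trans (ler_norm _) (b _ _ t1)) (b _ _ x1).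
  have h2 : `|phi t0 x0 - u n t0 x0| <= C / 2 ^+ n.
    apply: HC; last by rewrite lerDl.
    by apply: le_trans (ler_norm _) _; rewrite lerDl.
  have h3 := Hd t x td xd.
  exact: dist_third Hn h1 h2 h3.
exists phi => // t x.
(* At negative times every iterate equals c, hence so does the limit. *)
have [t0|t0] := ltP t 0.
  rewrite vop_lt0// addr0; apply/eqP; rewrite -subr_eq0 -normr_eq0.
  apply/negPn/negP => h; have hp : 0 < `|phi t x - c t x| by rewrite lt0r h /=.
  have [C _ HC] := rate 0 `|x| (lexx _).
  have [n] := half_small C hp; apply/negP; rewrite -leNgt.
  have := HC n t x (ltW t0) (lexx _); case: n => [|n].
    by rewrite u0.
  by rewrite uS vop_lt0// addr0.
have [C C0 HC] := rate t `|x| t0.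
have [K K0 HK] := jcont_bounded t `|x| cA.
pose L := 2 * K + 1.
have L0 : 0 < L by rewrite /L; lra.
have KL : 2 * K <= L ^+ 2 by exact: double_le_sqr.
apply/eqP; rewrite -subr_eq0 -normr_eq0; apply/negPn/negP => h.
have hp : 0 < `|phi t x - (c t x + vop A phi t x)| by rewrite lt0r h /=.
(* The defect of the equation is at most C (1 + e^{Lt}) / 2^n for every n: one part from phi -
   u_{n+1}, the other from [vop] applied to u_n - phi. *)
have [n] := half_small (C * (1 + expR (L * t))) hp; apply/negP; rewrite -leNgt.
have wt : forall s y, 0 <= s <= t -> `|y| <= `|x| ->
    `|u n s y - phi s y| <= C / 2 ^+ n * expR (L * s).
  move=> s y /andP[s0 st] yx; rewrite distrC (le_trans (HC n s y st yx))//.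
  rewrite ler_peMr ?divr_ge0 ?exprn_ge0//.
  by rewrite -expR0 ler_expR mulr_ge0// ltW.
have tt : 0 <= t <= t by rewrite t0 lexx.
have := vop_weight L0 KL cA (jcontB (cu n) cphi) HK wt tt (lexx _).
rewrite -(vopB cA (cu n) cphi) => h1; have := HC n.+1 t x (lexx _) (lexx _).
rewrite uS => h2.
have h3 : C / 2 ^+ n.+1 <= C / 2 ^+ n.
  rewrite ler_wpM2l// lef_pV2 ?posrE ?exprn_gt0// ler_eXn2l ?ltr1n//.
rewrite (_ : _ - _ = (phi t x - (c t x + vop A (u n) t x)) +
  (vop A (u n) t x - vop A phi t x)); last by ring.
apply: le_trans (ler_normD _ _) _.
rewrite mulrDr mulr1 mulrDl; apply: lerD; first exact: le_trans h2 h3.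
apply: le_trans h1 _; rewrite [leRHS]mulrAC ler_wpM2r ?expR_ge0//.
exact: (ler_half (divr_ge0 C0 (exprn_ge0 n (ler0n _ 2)))).
Qed.

End VolterraParameter.

(** * Families with jointly continuous space derivatives *)

Section SmoothFamilies.
Variable R : realType.
Implicit Types (d e t s x y K L M T C : R) (f g h A c phi : R -> R -> R).
Local Opaque vop.

(** C^j in x with every derivative up to order j jointly continuous in (t, x); in t only continuity
    is asked. Derivatives are existential witnesses, so closure properties are inductions on
    explicit formulas. *)
Fixpoint smooth (j : nat) f : Prop := jcont f /\
  if j is j'.+1 then
    exists2 f' : R -> R -> R, (forall t x, is_derive x 1 (f t) (f' t x)) & smooth j' f'
  else True.

Lemma smooth_jcont j f : smooth j f -> jcont f.
Proof. by case: j => [|j] []. Qed.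

Lemma smoothW j f : smooth j.+1 f -> smooth j f.
Proof.
elim: j f => [|j IHj] f; first by move=> [].
by move=> [cf [f' df sf']]; split => //; exists f' => //; exact: IHj.
Qed.

Lemma smooth_time j (h : R -> R) : continuous h -> smooth j (fun t _ => h t).
Proof.
elim: j h => [|j IHj] h ch; split=> //; try exact: jcont_time.
exists (fun _ _ => 0) => [t x|]; first exact: is_derive_cst.
by apply: (IHj (fun=> 0)) => x; exact: cst_continuous.
Qed.

Lemma smooth_cst j k : smooth j (fun _ _ => k).
Proof. by apply: (smooth_time j (h := fun=> k)) => x; exact: cst_continuous. Qed.

Lemma smoothD j f g : smooth j f -> smooth j g -> smooth j (fun t x => f t x + g t x).
Proof.
elim: j f g => [|j IHj] f g.
  by move=> [cf _] [cg _]; split => //; exact: jcontD.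
move=> [cf [f' df sf]] [cg [g' dg sg]]; split; first exact: jcontD.
exists (fun t x => f' t x + g' t x) => [t x|]; last exact: IHj.
by have := df t x; have := dg t x => ? ?; exact: is_deriveD.
Qed.

Lemma smoothM j f g : smooth j f -> smooth j g -> smooth j (fun t x => f t x * g t x).
Proof.
elim: j f g => [|j IHj] f g.
  by move=> [cf _] [cg _]; split => //; exact: jcontM.
move=> sf0 sg0; have sfj := smoothW sf0; have sgj := smoothW sg0.
case: sf0 => cf [f' df sf]; case: sg0 => cg [g' dg sg]; split; first exact: jcontM.
exists (fun t x => f t x * g' t x + g t x * f' t x) => [t x|].
  by have := df t x; have := dg t x => ? ?; exact: is_deriveM.
by apply: smoothD; exact: IHj.
Qed.

Lemma smoothZ j k f : smooth j f -> smooth j (fun t x => k * f t x).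
Proof. by apply: smoothM; exact: smooth_cst. Qed.

Lemma smoothB j f g : smooth j f -> smooth j g -> smooth j (fun t x => f t x - g t x).
Proof.
move=> sf sg; rewrite (_ : (fun _ _ => _) = fun t x => f t x + -1 * g t x).
  by apply: smoothD => //; exact: smoothZ.
by apply/funext => t; apply/funext => x; rewrite mulN1r.
Qed.

Lemma smooth_exp j f : smooth j f -> smooth j (fun t x => expR (f t x)).
Proof.
elim: j f => [|j IHj] f; first by move=> [cf _]; split => //; exact: jcont_exp.
move=> sf0; have sfj := smoothW sf0; case: sf0 => cf [f' df sf].
split; first exact: jcont_exp.
exists (fun t x => expR (f t x) * f' t x) => [t x|]; last by apply: smoothM => //; exact: IHj.
by have := df t x => ?; apply: is_derive1_comp.
Qed.

Lemma smooth_space j (h : nat -> R -> R) : (forall i, (i <= j)%N -> continuous (h i)) ->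
  (forall i x, (i < j)%N -> is_derive x 1 (h i) (h i.+1 x)) -> smooth j (fun _ => h 0%N).
Proof.
elim: j h => [|j IHj] h ch dh; split=> //; try by apply/jcont_space/ch.
exists (fun _ => h 1%N) => [t x|]; first exact: dh.
by apply: (IHj (fun i => h i.+1)) => [i ij|i x ij]; [exact: ch|exact: dh].
Qed.

(** The mean value theorem turns the quotient into f' at a point near x, and f' is continuous in x
    uniformly for |t| <= T. *)
Lemma quot_unif f (f' : R -> R -> R) T x e : (forall t x, is_derive x 1 (f t) (f' t x)) ->
  jcont f' -> 0 < e -> exists2 d : R, 0 < d &
  forall k t, k != 0 -> `|k| < d -> `|t| <= T ->
    `|(f t (x + k) - f t x) / k - f' t x| <= e.
Proof.
move=> df cf' e0; have [d d0 Hd] := jcont_tube x T (jcont_swap cf') e0.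
exists d => // k t k0 kd tT.
have cft : continuous (f t) by exact: is_derive_cont (df t).
have [xi xik ->] : exists2 xi, `|xi - x| < d & f t (x + k) - f t x = f' t xi * k.
  have [kp|kn] := ltP 0 k.
    have [|xi] := @MVT R (f t) (f' t) x (x + k) _ (fun y _ => df t y) (continuous_subspaceT cft).
      by rewrite ltrDl.
    rewrite in_itv/= => /andP[h1 h2] ->; exists xi; last by rewrite addrC addKr.
    by move/ltr_normlP: kd => [? ?]; apply/ltr_normlP; split; lra.
  have {}kn : k < 0 by rewrite lt_neqAle k0.
  have [|xi] := @MVT R (f t) (f' t) (x + k) x _ (fun y _ => df t y) (continuous_subspaceT cft).
    by rewrite -ltrBDl subrr.
  rewrite in_itv/= => /andP[h1 h2] h3; exists xi.
    by move/ltr_normlP: kd => [? ?]; apply/ltr_normlP; split; lra.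
  by rewrite -opprB h3; ring.
rewrite mulfK//; exact/ltW/Hd.
Qed.

Lemma vprim_quot f g x k t : jcont f -> jcont g ->
  (vprim f t (x + k) - vprim f t x) / k - vprim g t x =
  prim (fun s => (f s (x + k) - f s x) / k - g s x) t.
Proof.
move=> cf cg.
have l1 := lint_cont (jcont1 (x := x + k) cf); have l2 := lint_cont (jcont1 (x := x) cf).
have lg := lint_cont (jcont1 (x := x) cg).
rewrite /vprim /prim -[in LHS]intabB// mulrC -intabZ; last exact: lintB.
rewrite -intabB//; last by apply: lintZ; exact: lintB.
by apply: eq_intab => s _; rewrite mulrC.
Qed.

Lemma jcont_quot f g x k : jcont f -> jcont g ->
  lint (fun s => (f s (x + k) - f s x) / k - g s x).
Proof.
move=> cf cg.
have l1 := lint_cont (jcont1 (x := x + k) cf); have l2 := lint_cont (jcont1 (x := x) cf).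
have lg := lint_cont (jcont1 (x := x) cg).
rewrite (_ : (fun _ => _) = fun s => k^-1 * (f s (x + k) - f s x) - g s x).
  by apply: lintB => //; apply: lintZ; exact: lintB.
by apply/funext => s; rewrite mulrC.
Qed.

(** Differentiation under the time integral, by uniform convergence of the quotients on [0, t]. *)
Lemma is_derive_vprim f (f' : R -> R -> R) : jcont f -> jcont f' ->
  (forall t x, is_derive x 1 (f t) (f' t x)) ->
  forall t x, is_derive x 1 (vprim f t) (vprim f' t x).
Proof.
move=> cf cf' df t x; apply: is_derive_quot => e e0.
have e1 : 0 < e / (`|t| + 1) by rewrite divr_gt0// ltr_wpDl.
have [d d0 Hd] := quot_unif `|t| x df cf' e1.
exists d => // k k0 kd; rewrite vprim_quot//.
have [t0|t0] := ltP t 0; first by rewrite prim_lt0// normr0 ltW.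
apply: (@le_trans _ _ (e / (`|t| + 1) * (t - 0))).
  apply: intab_bound => //; first exact: jcont_quot.
  by move=> s /andP[s0 st]; apply: Hd => //; rewrite !ger0_norm.
rewrite subr0 mulrAC ler_pdivrMr ?ltr_wpDl// ler_wpM2l ?(ltW e0)//.
by rewrite (le_trans (ler_norm t))// lerDl.
Qed.

Lemma smooth_vprim j f : smooth j f -> smooth j (vprim f).
Proof.
elim: j f => [|j IHj] f; first by move=> [cf _]; split => //; exact: jcont_vprim.
move=> [cf [f' df sf]]; split; first exact: jcont_vprim.
exists (vprim f'); last exact: IHj.
by apply: is_derive_vprim => //; exact: smooth_jcont sf.
Qed.

End SmoothFamilies.

(** * Space regularity of solutions of Volterra equations *)

Section VolterraSmooth.
Variable R : realType.
Implicit Types (d e t s x y K L M T C : R) (f g h A c phi : R -> R -> R).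

Lemma prim_bound (f : R -> R) B T : lint f -> 0 <= T -> (forall s, 0 <= s <= T -> `|f s| <= B) ->
  forall s, 0 <= s <= T -> `|prim f s| <= B * T.
Proof.
move=> lf T0 fB s /andP[s0 sT].
have B0 : 0 <= B by apply: le_trans (fB 0 _); rewrite ?lexx.
apply: (@le_trans _ _ (B * (s - 0))); last by rewrite subr0 ler_wpM2l.
by apply: intab_bound => // r /andP[r0 rs]; apply: fB; rewrite r0 (le_trans rs).
Qed.

Lemma primD (f g : R -> R) s : lint f -> lint g ->
  prim (fun s => f s + g s) s = prim f s + prim g s.
Proof. exact: intabD. Qed.

Lemma eq_prim (f g : R -> R) s : f =1 g -> prim f s = prim g s.
Proof. by move=> /funext ->. Qed.

(** [chi] solves the equation differentiated formally in x. The error z of the difference quotient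
    of phi against [chi] solves the same kind of equation: a small term from c, plus the double
    primitives of A z and of a small remainder r. Gronwall then makes z small. *)
Lemma is_derive_volterra A A' c c' phi chi : jcont A' -> jcont c -> jcont c' -> jcont phi -> jcont chi ->
  (forall t x, is_derive x 1 (A t) (A' t x)) -> jcont A ->
  (forall t x, is_derive x 1 (c t) (c' t x)) ->
  volterra A c phi -> volterra A (fun t x => c' t x + vop A' phi t x) chi ->
  forall t x, is_derive x 1 (phi t) (chi t x).
Proof.
move=> cA' cc cc' cphi cchi dA cA dc Vphi Vchi T x.
have [T0|T0] := ltP T 0.
  have -> : phi T = c T by apply/funext => y; rewrite Vphi vop_lt0// addr0.
  by rewrite Vchi !vop_lt0// !addr0.
apply: is_derive_quot => e e0.
have [K K0 HK] := jcont_bounded T `|x| cA.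
(* phi will be evaluated at x + k with |k| < 1, hence the wider box. *)
have [Kp Kp0 HKp] := jcont_bounded T (`|x| + 1) cphi.
have [Ka Ka0 HKa] := jcont_bounded T `|x| cA'.
pose L := 2 * K + 1; have KL : 2 * K <= L ^+ 2 by exact: double_le_sqr.
have L0 : 0 < L by rewrite /L; lra.
(* With all quotient and continuity errors below eta, c contributes eta and the double primitive of
   r at most eta (Kp + Ka) T^2. [eta] is set so that the Gronwall bound 2 eta S e^{LT} equals e. *)
pose S := 1 + (Kp + Ka) * T * T.
have S0 : 0 < S by rewrite /S ltr_pwDl// !mulr_ge0//; lra.
pose eta := e / (2 * S * expR (L * T)).
have eta0 : 0 < eta by rewrite divr_gt0// !mulr_gt0// expR_gt0.
have [d1 d10 H1] := quot_unif T x dc cc' eta0.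
have [d2 d20 H2] := quot_unif T x dA cA' eta0.
have [d3 d30 H3] := jcont_tube x T (jcont_swap cphi) eta0.
exists (Num.min 1 (Num.min d1 (Num.min d2 d3))) => [|k k0].
  by rewrite !lt_min d10 d20 d30 ltr01.
rewrite !lt_min => /andP[kx /andP[k1 /andP[k2 k3]]].
pose z s := (phi s (x + k) - phi s x) / k - chi s x.
pose r s := (A s (x + k) - A s x) / k * phi s (x + k) - A' s x * phi s x.
have C1 f y : jcont f -> continuous (f ^~ y) by exact: jcont1.
have cz : continuous z.
  move=> s; apply: (@continuousB _ R R (fun s => (phi s (x + k) - phi s x) / k)); last exact: C1.
  apply: (@continuousM R R (fun s => phi s (x + k) - phi s x) (cst k^-1)); last exact: cst_continuous.
  by apply: (@continuousB _ R R (phi ^~ (x + k))); exact: C1.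
have cr : continuous r.
  move=> s; apply: (@continuousB _ R R (fun s => (A s (x + k) - A s x) / k * phi s (x + k))).
    apply: (@continuousM R R (fun s => (A s (x + k) - A s x) / k)); last exact: C1.
    apply: (@continuousM R R (fun s => A s (x + k) - A s x) (cst k^-1)); last exact: cst_continuous.
    by apply: (@continuousB _ R R (A ^~ (x + k))); exact: C1.
  by apply: (@continuousM R R (A' ^~ x) (phi ^~ x)); exact: C1.
have cAz : continuous (fun s => A s x * z s).
  by move=> s; apply: (@continuousM R R (A ^~ x) z); [exact: C1|exact: cz].
have zE s : z s = ((c s (x + k) - c s x) / k - c' s x) +
    (prim (prim (fun s => A s x * z s)) s + prim (prim r) s).
  have cAp : jcont (fun t x => A t x * phi t x) by exact: jcontM.
  have cg : jcont (fun t x => A t x * chi t x + A' t x * phi t x).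
    by apply: jcontD; exact: jcontM.
  have -> : prim (prim (fun s => A s x * z s)) s + prim (prim r) s =
      (vop A phi s (x + k) - vop A phi s x) / k - (vop A chi s x + vop A' phi s x).
    have -> : vop A chi s x + vop A' phi s x =
        vprim (vprim (fun t x => A t x * chi t x + A' t x * phi t x)) s x.
      have h1 := jcontM cA cchi; have h2 := jcontM cA' cphi.
      have l1 := lint_cont (jcont1 (x := x) (jcont_vprim h1)).
      have l2 := lint_cont (jcont1 (x := x) (jcont_vprim h2)).
      have l3 := lint_cont (jcont1 (x := x) h1); have l4 := lint_cont (jcont1 (x := x) h2).
      rewrite /vop {1 2 3}/vprim -(primD _ l1 l2).
      by apply: eq_prim => p; rewrite /vprim -(primD _ l3 l4).
    rewrite /vop vprim_quot; [|exact: jcont_vprim|exact: jcont_vprim].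
    rewrite -primD; [|exact/lint_cont/prim_cont|exact/lint_cont/prim_cont].
    apply: eq_prim => p; rewrite vprim_quot// -primD; [|exact: lint_cont|exact: lint_cont].
    by apply: eq_prim => q; rewrite /z /r; ring.
  rewrite {1}/z !Vphi Vchi.
  by move: (vop A phi s _) (vop A phi s x) (vop A chi s x) (vop A' phi s x) => *; ring.
have sT_norm s : 0 <= s <= T -> `|s| <= T by case/andP => s0 sT; rewrite ger0_norm.
have rb s : 0 <= s <= T -> `|r s| <= eta * (Kp + Ka).
  move=> /sT_norm sT.
  rewrite (_ : r s = ((A s (x + k) - A s x) / k - A' s x) * phi s (x + k) +
    A' s x * (phi s (x + k) - phi s x)); last by rewrite /r; ring.
  apply: le_trans (ler_normD _ _) _; rewrite !normrM mulrDr; apply: lerD.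
    apply: ler_pM => //; first exact: H2.
    by apply: HKp => //; rewrite (le_trans (ler_normD _ _))// lerD// ltW.
  rewrite mulrC; apply: ler_pM => //; last exact: HKa.
  by apply/ltW/H3 => //; rewrite addrC addKr.
have ppr s : 0 <= s <= T -> `|prim (prim r) s| <= eta * ((Kp + Ka) * T * T).
  move=> sT; rewrite !mulrA; apply: prim_bound => //.
    exact/lint_cont/prim_cont.
  by apply: prim_bound => //; exact: lint_cont.
have zb s : 0 <= s <= T -> `|z s| <= eta * S + `|prim (prim (fun s => A s x * z s)) s|.
  move=> sT; rewrite {1}zE /S mulrDr mulr1.
  have h1 := H1 k s k0 k1 (sT_norm s sT); have h2 := ppr s sT.
  apply: le_trans (ler_normD _ _) _; rewrite -addrA; apply: lerD => //.
  by apply: le_trans (ler_normD _ _) _; rewrite addrC; apply: lerD.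
have TT : 0 <= T <= T by rewrite T0 lexx.
have zT := volterra_gronwall L0 KL T0 (C1 _ x cA) cz
  (fun s sT => HK s x (sT_norm s sT) (lexx _)) zb TT.
rewrite -/(z T); apply: (le_trans zT).
rewrite le_eqVlt; apply/orP; left; apply/eqP; rewrite /eta; field.
by rewrite !gt_eqF ?expR_gt0.
Qed.

(** The derivative chi solves an equation with the same A and the datum c' + vop A' phi, which has
    order j as soon as phi has. The induction hypothesis thus serves twice, for phi and for chi, and
    must hold for all c. *)
Lemma smooth_volterra j A c phi : smooth j A -> smooth j c -> jcont phi ->
  volterra A c phi -> smooth j phi.
Proof.
elim: j c phi => [|j IHj] c phi sA sc cphi V; split => //.
have cA := smooth_jcont sA; have cc := smooth_jcont sc.
have sAj := smoothW sA; have scj := smoothW sc.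
have sphi := IHj c phi sAj scj cphi V.
case: sA => _ [A' dA sA']; case: sc => _ [c' dc sc'].
have sc'' : smooth j (fun t x => c' t x + vop A' phi t x).
  by apply: smoothD => //; do 2 apply: smooth_vprim; exact: smoothM.
have [chi cchi Vchi] := volterra_exists cA (smooth_jcont sc'').
exists chi; last exact: IHj Vchi.
have cA' := smooth_jcont sA'; have cc' := smooth_jcont sc'.
exact: is_derive_volterra cA' cc cc' cphi cchi dA cA dc V Vchi.
Qed.

End VolterraSmooth.

(** * Local L^2 functions and L^2 derivatives in time *)

Section L2.
Variable R : realType.
Implicit Types (a b d e t s x y K L M T C : R) (f g h : R -> R).

(** L^2_loc of the line; the first component carries the measurability of [f], which its square
    alone does not give. *)
Definition l2 f := lint f /\ lint (fun x => f x ^+ 2).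

Lemma l2_mul f g : l2 f -> l2 g -> lint (fun x => f x * g x).
Proof.
move=> [lf lf2] [lg lg2].
apply: (@lint_le _ _ (fun x => f x ^+ 2 + g x ^+ 2)); last exact: lintD.
  by move=> a b; apply: measurable_funM; exact: lint_meas.
by move=> x; rewrite ler_norml; apply/andP; split; nra.
Qed.

Lemma l2Z k f : l2 f -> l2 (fun x => k * f x).
Proof.
move=> [lf lf2]; split; first exact: lintZ.
rewrite (_ : (fun _ => _) = fun x => k ^+ 2 * f x ^+ 2); first exact: lintZ.
by apply/funext => x; rewrite exprMn.
Qed.

Lemma l2D f g : l2 f -> l2 g -> l2 (fun x => f x + g x).
Proof.
move=> l2f l2g; have lfg := l2_mul l2f l2g; case: l2f l2g => [lf lf2] [lg lg2].
split; first exact: lintD.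
rewrite (_ : (fun _ => _) = fun x => f x ^+ 2 + g x ^+ 2 + 2 * (f x * g x)).
  by apply: lintD; [exact: lintD|exact: lintZ].
by apply/funext => x; ring.
Qed.

Lemma l2B f g : l2 f -> l2 g -> l2 (fun x => f x - g x).
Proof.
move=> lf lg; rewrite (_ : (fun _ => _) = fun x => f x + -1 * g x).
  by apply: l2D => //; exact: l2Z.
by apply/funext => x; rewrite mulN1r.
Qed.

Lemma l2_mulc f g : continuous f -> l2 g -> l2 (fun x => f x * g x).
Proof.
move=> cf [lg lg2]; split; first exact: lint_mulc.
rewrite (_ : (fun _ => _) = fun x => f x ^+ 2 * g x ^+ 2).
  apply: lint_mulc => // x.
  by apply: (@continuous_comp _ _ _ f (fun y => y ^+ 2)); [exact: cf|exact: exprn_continuous].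
by apply/funext => x; rewrite exprMn.
Qed.

Lemma l2_cont f : continuous f -> l2 f.
Proof.
move=> cf; split; first exact: lint_cont.
apply: lint_cont => x.
by apply: (@continuous_comp _ _ _ f (fun y => y ^+ 2)); [exact: cf|exact: exprn_continuous].
Qed.

Lemma l2_quot f g h k : l2 f -> l2 g -> l2 h -> l2 (fun x => (f x - g x) / k - h x).
Proof.
move=> lf lg lh; apply: l2B => //.
rewrite (_ : (fun _ => _) = fun x => k^-1 * (f x - g x)).
  by apply: l2Z; exact: l2B.
by apply/funext => x; rewrite mulrC.
Qed.

Lemma inL2_l2 f : periodic1 f -> inL2 f -> l2 f.
Proof.
move=> pf [mf if2]; split; last first.
  by apply: periodic_lint => // x; rewrite pf.
apply: periodic_lint => //.
have h : (@lebesgue_measure R).-integrable `[0, 1] (EFin \o (fun x => 1 + f x ^+ 2)).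
  apply: (@integrableD _ _ _ (@lebesgue_measure R) _ _ (EFin \o cst 1)
    (fun x => (f x ^+ 2)%:E)) => //.
  exact: lint_cst.
apply: (@le_integrable _ _ _ (@lebesgue_measure R) _ _ _
  (EFin \o (fun x => 1 + f x ^+ 2))) => //.
  by apply/measurable_EFinP.
move=> x _ /=; rewrite lee_fin (ger0_norm (_ : 0 <= 1 + f x ^+ 2)) ?addr_ge0 ?sqr_ge0//.
by rewrite ler_norml; apply/andP; split; nra.
Qed.

Lemma L2norm_lt f e : L2norm f < e -> intab 0 1 (fun x => f x ^+ 2) <= e ^+ 2.
Proof.
move=> h; have e0 : 0 < e by apply: le_lt_trans h; exact: sqrtr_ge0.
have I0 : 0 <= intab 0 1 (fun x => f x ^+ 2) by apply: intab_ge0 => x; exact: sqr_ge0.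
by rewrite -(sqr_sqrtr I0) ler_sqr ?nnegrE ?sqrtr_ge0// ltW.
Qed.

Lemma L2norm_eq0 f : L2norm f = 0 -> intab 0 1 (fun x => f x ^+ 2) = 0.
Proof.
move=> h.
have I0 : 0 <= intab 0 1 (fun x => f x ^+ 2) by apply: intab_ge0 => x; exact: sqr_ge0.
by rewrite -(sqr_sqrtr I0) -/(L2norm f) h expr0n.
Qed.

(** The difference of the two sides is k (p - w)^2. The weight k keeps the factor of p^2 at 1 + k,
    as an energy inequality over a time step k requires. *)
Lemma sqD_weight (k p w : R) : 0 <= k -> (p + k * w) ^+ 2 <= (1 + k) * p ^+ 2 + (k + k ^+ 2) * w ^+ 2.
Proof.
move=> k0; rewrite -subr_ge0.
rewrite (_ : _ - _ = k * (p - w) ^+ 2); last by ring.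
by rewrite mulr_ge0// sqr_ge0.
Qed.

(** The counterpart of [L2_deriv_at] on every [-M, M], for comparison with functions that need not
    be periodic; squares of norms avoid the root. *)
Definition L2loc_deriv (X Y : R -> R -> R) t := forall M e, 0 < e -> exists2 d : R, 0 < d &
  forall k, k != 0 -> `|k| < d -> 0 <= t + k ->
    intab (- M) M (fun x => ((X (t + k) x - X t x) / k - Y t x) ^+ 2) <= e.

Lemma L2_deriv_L2loc_deriv X Y t : 0 <= t -> (forall s, 0 <= s -> periodic1 (X s) /\ l2 (X s)) ->
  periodic1 (Y t) -> l2 (Y t) -> L2_deriv_at X Y t -> L2loc_deriv X Y t.
Proof.
move=> t0 pX pY lY XY M e e0.
have [K K0 HK] := periodic_intab_le M.
(* As e1 <= 1, the square of the norm is below e1, and multiplied by [K] it stays below e. *)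
pose e1 := Num.min 1 (e / (K + 1)).
have e10 : 0 < e1 by rewrite lt_min ltr01 divr_gt0// ltr_wpDl.
have [d d0 Hd] := XY e1 e10; exists d => // k k0 kd tk.
have [ptk ltk] := pX _ tk; have [pt lt] := pX _ t0.
apply: le_trans (HK _ _ _ _ _ _ (lexx _) (lexx _)) _.
- by move=> x; rewrite ptk pt pY.
- by have [] := l2_quot k ltk lt lY.
- by move=> x; exact: sqr_ge0.
have := L2norm_lt (Hd k k0 kd tk) => h.
have e11 : e1 ^+ 2 <= e1.
  by rewrite expr2 ler_piMl ?(ltW e10)// ge_min lexx.
have e1e : e1 <= e / (K + 1) by rewrite ge_min lexx orbT.
apply: le_trans (ler_wpM2l K0 (le_trans h (le_trans e11 e1e))) _.
by rewrite mulrCA ler_piMr ?(ltW e0)// ler_pdivrMr ?mul1r ?lerDl// ltr_wpDl.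
Qed.

Lemma L2loc_derivB X Y X' Y' t : 0 <= t ->
  (forall s, 0 <= s -> l2 (X s)) -> (forall s, 0 <= s -> l2 (X' s)) -> l2 (Y t) -> l2 (Y' t) ->
  L2loc_deriv X Y t -> L2loc_deriv X' Y' t -> L2loc_deriv (fun t x => X t x - X' t x) (fun t x => Y t x - Y' t x) t.
Proof.
move=> t0 lX lX' lY lY' H H' M e e0.
have e4 : 0 < e / 4 by rewrite divr_gt0.
have [d d0 Hd] := H M _ e4; have [d' d'0 Hd'] := H' M _ e4.
exists (Num.min d d') => [|k k0]; first by rewrite lt_min d0.
rewrite lt_min => /andP[kd kd'] tk.
have [_ q1] := l2_quot k (lX _ tk) (lX _ t0) lY.
have [_ q2] := l2_quot k (lX' _ tk) (lX' _ t0) lY'.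
have [_ q3] := l2_quot k (l2B (lX _ tk) (lX' _ tk)) (l2B (lX _ t0) (lX' _ t0)) (l2B lY lY').
apply: (@le_trans _ _ (intab (- M) M (fun x =>
   2 * ((X (t + k) x - X t x) / k - Y t x) ^+ 2 +
   2 * ((X' (t + k) x - X' t x) / k - Y' t x) ^+ 2))).
  apply: le_intab => //; first by apply: lintD; exact: lintZ.
  move=> x _.
  set p := (X (t + k) x - X t x) / k - Y t x; set q := (X' (t + k) x - X' t x) / k - Y' t x.
  rewrite (_ : _ - _ = p - q); last by rewrite /p /q; ring.
  by have := sqr_ge0 (p + q); nra.
rewrite intabD; [|exact: lintZ|exact: lintZ].
rewrite !intabZ//; have h1 := Hd k k0 kd tk; have h2 := Hd' k k0 kd' tk.
lra.
Qed.

Lemma L2loc_deriv_prim (phi psi : R -> R -> R) (c : R -> R) t : 0 <= t -> jcont phi -> jcont psi ->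
  (forall s x, 0 <= s -> phi s x = c x + vprim psi s x) -> L2loc_deriv phi psi t.
Proof.
move=> t0 cphi cpsi E M e e0.
have [M0|M0] := ltP M 0.
  by exists 1 => // k *; rewrite intab_gt ?(ltW e0)//; lra.
have M1 : 0 < 2 * M + 1 by lra.
pose e1 := Num.min 1 (e / (2 * M + 1)).
have e10 : 0 < e1 by rewrite lt_min ltr01 divr_gt0.
have e11 : e1 ^+ 2 <= e1.
  by rewrite expr2 ler_piMl ?(ltW e10)// ge_min lexx.
have e1e : e1 <= e / (2 * M + 1) by rewrite ge_min lexx orbT.
have [d d0 Hd] := jcont_tube t M cpsi e10.
exists d => // k k0 kd tk.
have l2t s : l2 (phi s) by apply: l2_cont; exact: jcont2.
have l2t' s : l2 (psi s) by apply: l2_cont; exact: jcont2.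
apply: (@le_trans _ _ (intab (- M) M (fun=> e / (2 * M + 1)))).
  apply: le_intab; [by case: (l2_quot k (l2t (t + k)) (l2t t) (l2t' t))|exact: lint_cst|].
  move=> x; rewrite -ler_norml => xM.
  have lpsi : lint (psi ^~ x) by apply: lint_cont; exact: jcont1.
  suff h : `|(phi (t + k) x - phi t x) / k - psi t x| <= e1.
    apply: le_trans e1e; apply: le_trans e11.
    by rewrite -(real_normK (num_real _)) ler_sqr ?nnegrE ?(ltW e10).
  rewrite !E// /vprim !prim_oint !max_r//.
  rewrite (_ : _ / k - _ = oint t (t + k) (fun s => psi s x - psi t x) / k).
    rewrite normrM normfV ler_pdivrMr ?normr_gt0//.
    have e2 : `|t + k - t| = `|k| by rewrite addrC addKr.
    rewrite -[in leRHS]e2; apply: norm_oint_cst => [|s]; first exact: lintB (lint_cst _).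
    by rewrite e2 => sk; apply/ltW/Hd => //; exact: le_lt_trans sk kd.
  rewrite ointB//; last exact: lint_cst.
  rewrite (oint_split t 0 (t + k) lpsi).
  have -> : oint t (t + k) (fun=> psi t x) = psi t x * k.
    rewrite /oint; case: ifPn => tk'; first by rewrite intab_cst// addrC addKr.
    rewrite intab_cst; first by ring.
    by rewrite ltW// ltNge.
  by field.
rewrite intab_cst; last lra.
rewrite mulrAC ler_pdivrMr//.
by rewrite ler_wpM2l ?(ltW e0)//; lra.
Qed.

End L2.

(** * Uniqueness for the linear equation in L^2 *)

Section L2Uniqueness.
Variable R : realType.
Implicit Types (a b d e t s x y K L M T C : R) (f g h : R -> R).

(* The last hypothesis replaces left continuity of [N]. *)
Lemma dini_comparison (N : R -> R) C T : 0 <= C -> 0 <= T -> N 0 <= 0 ->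
  (forall t e, 0 <= t <= T -> 0 < e -> exists2 d : R, 0 < d & forall k, 0 < k < d ->
     N (t + k) <= (1 + C * k) * N t + e * k) ->
  (forall t, 0 < t <= T -> exists K, exists2 d : R, 0 < d & forall k, 0 < k < d -> k <= t ->
     N t <= (1 + k) * N (t - k) + k * K) ->
  N T <= 0.
Proof.
move=> C0 T0 N0 Hr Hl.
suff H e : 0 < e -> N T <= e * expR ((C + 1) * T).
  rewrite leNgt; apply/negP => NT.
  have := H (N T / 2 / expR ((C + 1) * T)).
  rewrite divfK ?gt_eqF ?expR_gt0// => /(_ _).
  by rewrite !divr_gt0 ?expR_gt0// => /(_ isT); lra.
(* The barrier grows at rate C + 1 instead of C and never falls below e, so the surplus absorbs the
   error e k of a step. *)
move=> e0; pose B t := e * expR ((C + 1) * t).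
have C1 : 0 <= C + 1 by rewrite addr_ge0.
have B0 t : 0 < B t by rewrite mulr_gt0// expR_gt0.
have Bm s t : s <= t -> B s <= B t.
  by move=> st; rewrite /B ler_wpM2l ?(ltW e0)// ler_expR ler_wpM2l.
have Be t : 0 <= t -> e <= B t.
  by move=> t0; rewrite /B ler_peMr ?(ltW e0)// -[leLHS]expR0 ler_expR mulr_ge0.
(* Continuation argument: [S] holds the times up to which N stays below the barrier, and its
   supremum must be T. *)
pose S := [set t | 0 <= t <= T /\ forall s, 0 <= s <= t -> N s <= B s].
have S0 : S 0.
  split; first by rewrite lexx.
  move=> s /andP[s0 s1]; have -> : s = 0 by lra.
  by apply: le_trans N0 _; exact: ltW.
have hS : has_sup S by split; [exists 0|exists T => t [/andP[_ ?] _]].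
set m := sup S.
have m0 : 0 <= m by apply: ub_le_sup => //; case: hS.
have mT : m <= T by apply: ge_sup; [exists 0|move=> t [/andP[_ ?] _]].
have below s : 0 <= s < m -> N s <= B s.
  move=> /andP[s0 sm]; have [t [_ tS] st] := sup_gt (ex_intro _ 0 S0) sm.
  by apply: tS; rewrite s0 ltW.
have atm : N m <= B m.
  move: m0; rewrite le_eqVlt => /predU1P[<-|m0].
    by apply: le_trans N0 _; exact: ltW.
  have [|K [d d0 Hd]] := Hl m; first by rewrite m0.
  rewrite leNgt; apply/negP => h.
  (* If N m exceeded B m, a backward step k this short would bound the excess N m - B m by half of
     itself. *)
  pose k := Num.min (Num.min (d / 2) m) ((N m - B m) / 2 / (`|B m + K| + 1)).
  have p1 : 0 < `|B m + K| + 1 by rewrite ltr_wpDl.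
  have k0 : 0 < k by rewrite !lt_min m0 !divr_gt0// subr_gt0.
  have kd : k < d by rewrite /k !gt_min ltr_pdivrMr// ltr_pMr// ltr1n.
  have km : k <= m by rewrite /k !ge_min lexx orbT.
  have h1 := Hd k; rewrite k0 kd in h1; have {h1} := h1 isT km.
  have h2 : N (m - k) <= B m.
    by apply: le_trans (below _ _) (Bm _ _ _); [apply/andP; split|]; lra.
  have h3 : (1 + k) * N (m - k) <= (1 + k) * B m by rewrite ler_wpM2l//; lra.
  have h4 : k * (B m + K) <= (N m - B m) / 2.
    apply: (@le_trans _ _ (k * (`|B m + K| + 1))).
      by rewrite ler_wpM2l ?(ltW k0)// (le_trans (ler_norm _))// lerDl.
    by rewrite -ler_pdivlMr// /k ge_min lexx orbT.
  lra.
have mS s : 0 <= s <= m -> N s <= B s.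
  move=> /andP[s0]; rewrite le_eqVlt => /predU1P[->//|sm].
  by apply: below; rewrite s0.
have [mT'|Tm] := ltP m T; last by rewrite (_ : T = m) //; apply/eqP; rewrite eq_le Tm.
have [||d d0 Hd] := Hr m e; [by rewrite m0 mT|by []|].
pose k := Num.min (d / 2) (T - m).
have k0 : 0 < k by rewrite lt_min divr_gt0// subr_gt0.
have kd : k < d by rewrite /k gt_min ltr_pdivrMr// ltr_pMr// ltr1n.
have kT : k <= T - m by rewrite /k ge_min lexx orbT.
have : m + k <= m.
  apply: ub_le_sup; first by case: hS.
  split; first by apply/andP; split; lra.
  move=> s /andP[s0 sk]; have [sm|ms] := leP s m; first by apply: mS; rewrite s0.
  have -> : s = m + (s - m) by ring.
  set r := s - m; have r0 : 0 < r by rewrite subr_gt0.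
  have rd : r < d by rewrite /r; lra.
  have := Hd r; rewrite r0 rd => /(_ isT) h; apply: le_trans h _.
  have h1 : (1 + C * r) * N m <= (1 + C * r) * B m.
    by rewrite ler_wpM2l// addr_ge0// mulr_ge0// ltW.
  have h2 : e * r <= B m * r by rewrite ler_wpM2r ?(ltW r0)// Be.
  apply: le_trans (lerD h1 h2) _.
  rewrite [leLHS](_ : _ = B m * (1 + (C + 1) * r)); last by ring.
  have -> : B (m + r) = B m * expR ((C + 1) * r) by rewrite /B mulrDr expRD mulrA.
  by rewrite ler_wpM2l ?(ltW (B0 m))// expR_ge1Dx.
by rewrite gerDl leNgt k0.
Qed.

(** The energy is N = int z^2 + int w^2 on [-M, M]. Since z and w have derivatives only in L^2_loc,
    the inequality N' <= C N is replaced by N(t + k) <= (1 + Ck) N(t) + ek for small steps, obtained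
    from the quotients. *)
Lemma l2_gronwall (z w A : R -> R -> R) M : jcont A ->
  (forall t, 0 <= t -> l2 (z t) /\ l2 (w t)) ->
  (forall t, 0 <= t -> L2loc_deriv z w t) ->
  (forall t, 0 <= t -> L2loc_deriv w (fun t x => A t x * z t x) t) ->
  intab (- M) M (fun x => z 0 x ^+ 2) = 0 -> intab (- M) M (fun x => w 0 x ^+ 2) = 0 ->
  forall t, 0 <= t -> intab (- M) M (fun x => z t x ^+ 2) = 0 /\
    intab (- M) M (fun x => w t x ^+ 2) = 0.
Proof.
move=> cA lzw dz dw z0 w0 T T0.
pose N t := intab (- M) M (fun x => z t x ^+ 2) + intab (- M) M (fun x => w t x ^+ 2).
have Iz0 t : 0 <= intab (- M) M (fun x => z t x ^+ 2) by apply: intab_ge0 => x; exact: sqr_ge0.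
have Iw0 t : 0 <= intab (- M) M (fun x => w t x ^+ 2) by apply: intab_ge0 => x; exact: sqr_ge0.
suff NT : N T <= 0.
  have := Iz0 T; have := Iw0 T; move: NT; rewrite /N => *; split; lra.
have [K K0 HK] := jcont_bounded T M cA.
have lz t : 0 <= t -> l2 (z t) by move=> /lzw[].
have lw t : 0 <= t -> l2 (w t) by move=> /lzw[].
have lAz t : 0 <= t -> l2 (fun x => A t x * z t x).
  by move=> t0; apply: l2_mulc; [exact: jcont2|exact: lz].
(* A step multiplies each square by at most 1 + 3k and adds 4k times the square of its derivative:
   w^2 collects 3 + 4, and z^2 collects 3 + 4 K^2 because |A z| <= K |z|. *)
pose C := 7 + 4 * K ^+ 2.
have C0 : 0 <= C by rewrite addr_ge0// mulr_ge0// sqr_ge0.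
apply: (dini_comparison C0 T0).
- by rewrite /N z0 w0 addr0.
- move=> t e /andP[t0 tT] e0.
  have e4 : 0 < e / 4 by rewrite divr_gt0.
  have [d1 d10 H1] := dz t t0 M _ e4; have [d2 d20 H2] := dw t t0 M _ e4.
  exists (Num.min 1 (Num.min d1 d2)) => [|k /andP[k0]]; first by rewrite !lt_min ltr01 d10.
  rewrite !lt_min => /andP[k1 /andP[kd1 kd2]].
  have kn0 : k != 0 by rewrite gt_eqF.
  have nk : `|k| = k by rewrite gtr0_norm.
  have tk : 0 <= t + k by rewrite addr_ge0// ltW.
  have := H1 k kn0; rewrite nk => /(_ kd1 tk) r1.
  have := H2 k kn0; rewrite nk => /(_ kd2 tk) r2.
  have [_ l1] := l2_quot k (lz _ tk) (lz _ t0) (lw _ t0).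
  have [_ l3] := l2_quot k (lw _ tk) (lw _ t0) (lAz _ t0).
  have [_ lz2] := lz _ t0; have [_ lw2] := lw _ t0.
  have [_ lz2'] := lz _ tk; have [_ lw2'] := lw _ tk.
  set rz := (fun x => ((z (t + k) x - z t x) / k - w t x) ^+ 2) in r1 l1.
  set rw := (fun x => ((w (t + k) x - w t x) / k - A t x * z t x) ^+ 2) in r2 l3.
  have key p q r : (p + k * q + k * r) ^+ 2 <= (1 + 3 * k) * p ^+ 2 + 4 * k * q ^+ 2 + 2 * k * r ^+ 2.
    have h1 := sqD_weight (p + k * q) r (ltW k0).
    have h2 := sqD_weight p q (ltW k0).
    have k2 := sqr_ge0 k; have kk : k ^+ 2 <= k by rewrite expr2 ler_piMr// ltW.
    have h3 : (1 + k) * (p + k * q) ^+ 2 <= (1 + k) * ((1 + k) * p ^+ 2 + (k + k ^+ 2) * q ^+ 2).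
      by rewrite ler_wpM2l//; lra.
    have h4 : (k + k ^+ 2) * r ^+ 2 <= 2 * k * r ^+ 2 by rewrite ler_wpM2r ?sqr_ge0//; lra.
    have h5 : (1 + k) * (1 + k) * p ^+ 2 <= (1 + 3 * k) * p ^+ 2.
      rewrite ler_wpM2r ?sqr_ge0// (_ : _ * _ = 1 + 2 * k + k ^+ 2); [lra|ring].
    have h6 : (1 + k) * (k + k ^+ 2) * q ^+ 2 <= 4 * k * q ^+ 2.
      rewrite ler_wpM2r ?sqr_ge0//; apply: (@le_trans _ _ (2 * (2 * k))); last lra.
      by apply: ler_pM; lra.
    lra.
  have tTn : `|t| <= T by rewrite ger0_norm.
  apply: (@le_trans _ _ (intab (- M) M (fun x =>
      (1 + C * k) * (z t x ^+ 2 + w t x ^+ 2) + 2 * k * (rz x + rw x)))).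
    rewrite /N -intabD//; apply: le_intab.
    - exact: lintD.
    - by apply: lintD; apply: lintZ; exact: lintD.
    move=> x; rewrite -ler_norml => xM.
    have -> : z (t + k) x = z t x + k * w t x + k * ((z (t + k) x - z t x) / k - w t x).
      by field.
    have -> : w (t + k) x = w t x + k * (A t x * z t x) +
        k * ((w (t + k) x - w t x) / k - A t x * z t x) by field.
    have h1 := key (z t x) (w t x) ((z (t + k) x - z t x) / k - w t x).
    have h2 := key (w t x) (A t x * z t x) ((w (t + k) x - w t x) / k - A t x * z t x).
    have h3 : 4 * k * (A t x * z t x) ^+ 2 <= 4 * k * (K ^+ 2 * z t x ^+ 2).
      rewrite ler_wpM2l ?mulr_ge0 ?(ltW k0)// exprMn ler_wpM2r ?sqr_ge0//.
      rewrite -(real_normK (num_real _)) ler_sqr ?nnegrE//; last exact: ltW.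
      exact: HK.
    rewrite -/(rz x) in h1; rewrite -/(rw x) in h2.
    have h4 : 0 <= k * z t x ^+ 2 by rewrite mulr_ge0 ?sqr_ge0// ltW.
    have h5 : 0 <= k * w t x ^+ 2 by rewrite mulr_ge0 ?sqr_ge0// ltW.
    have h6 : 0 <= k * w t x ^+ 2 * K ^+ 2 by rewrite mulr_ge0 ?sqr_ge0.
    rewrite /C; lra.
  rewrite intabD; [|by apply: lintZ; exact: lintD|by apply: lintZ; exact: lintD].
  rewrite intabZ; last exact: lintD.
  rewrite intabZ; last exact: lintD.
  rewrite intabD// intabD// -/(N t) lerD2l.
  have : intab (- M) M rz + intab (- M) M rw <= e / 2 by lra.
  by move=> h; have := ler_wpM2l (ltW k0) h; lra.
- move=> t /andP[t0 tT]; have t0' := ltW t0.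
  have [d1 d10 H1] := dz t t0' M _ ltr01; have [d2 d20 H2] := dw t t0' M _ ltr01.
  (* Going back from t, the increments are the derivatives at t plus quotient errors; the two
     squared errors have integral at most 1 each, hence the 2. *)
  exists (4 * (N t + intab (- M) M (fun x => (A t x * z t x) ^+ 2) + 2)).
  exists (Num.min 1 (Num.min d1 d2)) => [|k /andP[k0]]; first by rewrite !lt_min ltr01 d10.
  rewrite !lt_min => /andP[k1 /andP[kd1 kd2]] kt.
  have kn0 : - k != 0 by rewrite oppr_eq0 gt_eqF.
  have nk : `|- k| = k by rewrite normrN gtr0_norm.
  have tk : 0 <= t - k by rewrite subr_ge0.
  have := H1 (- k) kn0; rewrite nk => /(_ kd1 tk) r1.
  have := H2 (- k) kn0; rewrite nk => /(_ kd2 tk) r2.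
  have [_ l1] := l2_quot (- k) (lz _ tk) (lz _ t0') (lw _ t0').
  have [_ l3] := l2_quot (- k) (lw _ tk) (lw _ t0') (lAz _ t0').
  have [_ lz2] := lz _ t0'; have [_ lw2] := lw _ t0'; have [_ lA2] := lAz _ t0'.
  have [_ lz2'] := lz _ tk; have [_ lw2'] := lw _ tk.
  set rz := (fun x => ((z (t - k) x - z t x) / (- k) - w t x) ^+ 2) in r1 l1.
  set rw := (fun x => ((w (t - k) x - w t x) / (- k) - A t x * z t x) ^+ 2) in r2 l3.
  have key p q r : (p + k * (q + r)) ^+ 2 <= (1 + k) * p ^+ 2 + 4 * k * (q ^+ 2 + r ^+ 2).
    apply: le_trans (sqD_weight p (q + r) (ltW k0)) _; rewrite lerD2l.
    have k2 := sqr_ge0 k; have kk : k ^+ 2 <= k by rewrite expr2 ler_piMr// ltW.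
    apply: (@le_trans _ _ (2 * k * (2 * (q ^+ 2 + r ^+ 2)))); last lra.
    apply: ler_pM; rewrite ?sqr_ge0 ?addr_ge0 ?sqr_ge0 ?(ltW k0)//; first lra.
    by have := sqr_ge0 (q - r); nra.
  have l12 := lintD l1 l3; have lzw2 := lintD lz2 lw2; have lzw2A := lintD lzw2 lA2.
  apply: (@le_trans _ _ (intab (- M) M (fun x =>
      (1 + k) * (z (t - k) x ^+ 2 + w (t - k) x ^+ 2) +
      4 * k * (z t x ^+ 2 + w t x ^+ 2 + (A t x * z t x) ^+ 2 + (rz x + rw x))))).
    rewrite /N -intabD//; apply: le_intab => //.
      apply: lintD; apply: lintZ; exact: lintD.
    move=> x _.
    have h0 : z t x ^+ 2 = (z (t - k) x + k * (w t x + ((z (t - k) x - z t x) / (- k) - w t x))) ^+ 2.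
      by congr (_ ^+ 2); field; rewrite gt_eqF.
    have h0' : w t x ^+ 2 = (w (t - k) x + k * (A t x * z t x +
        ((w (t - k) x - w t x) / (- k) - A t x * z t x))) ^+ 2.
      by congr (_ ^+ 2); field; rewrite gt_eqF.
    have h1 := key (z (t - k) x) (w t x) ((z (t - k) x - z t x) / (- k) - w t x).
    have h2 := key (w (t - k) x) (A t x * z t x) ((w (t - k) x - w t x) / (- k) - A t x * z t x).
    rewrite -h0 -/(rz x) in h1; rewrite -h0' -/(rw x) in h2.
    have h4 : 0 <= k * z t x ^+ 2 by rewrite mulr_ge0 ?sqr_ge0// ltW.
    lra.
  rewrite intabD; [|by apply: lintZ; exact: lintD|by apply: lintZ; exact: lintD].
  rewrite intabZ; last exact: lintD.
  rewrite intabZ; last exact: lintD.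
  rewrite intabD// intabD// intabD// intabD// intabD// -/(N t) -/(N (t - k)) lerD2l.
  have h : intab (- M) M rz + intab (- M) M rw <= 2 by lra.
  by have := ler_wpM2l (ltW k0) h; lra.
Qed.

End L2Uniqueness.

(** * Continuous curves in L^2 and almost everywhere equality *)

Section L2Curves.
Variable R : realType.
Notation mu := (@lebesgue_measure R).
Implicit Types (a b d e t s x y K L M T C : R) (f g h : R -> R).

Definition L2_curve (r : R -> R -> R) := (forall t, l2 (r t)) /\
  forall t0 M e, 0 < e -> exists2 d : R, 0 < d & forall t, `|t - t0| < d ->
    intab (- M) M (fun x => (r t x - r t0 x) ^+ 2) <= e.

Lemma amgm (l p q : R) : 0 < l -> `|p * q| <= l / 2 * p ^+ 2 + (2 * l)^-1 * q ^+ 2.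
Proof.
move=> l0; rewrite -subr_ge0 -(real_normK (num_real p)) -(real_normK (num_real q)) normrM.
rewrite (_ : _ - _ = (2 * l)^-1 * (l * `|p| - `|q|) ^+ 2); last by field; rewrite gt_eqF.
by rewrite mulr_ge0 ?sqr_ge0// invr_ge0 mulr_ge0// ltW.
Qed.

(** The increment of r s is dr ds + s0 dr + r0 ds. Young's inequality puts a weight l on the fixed
    factors with l N <= e; the increments then carry the factor k = 1 + 1/l, against which their
    size is chosen. *)
Lemma L2_curve_mul (r s : R -> R -> R) : L2_curve r -> L2_curve s -> L1_curve (fun t x => r t x * s t x).
Proof.
move=> [lr cr] [ls cs]; split=> [t|t0 M e e0]; first exact: l2_mul.
set N := intab (- M) M (fun x => r t0 x ^+ 2) + intab (- M) M (fun x => s t0 x ^+ 2).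
have N0 : 0 <= N by apply: addr_ge0; apply: intab_ge0 => x; exact: sqr_ge0.
have N1 : 0 < N + 1 by rewrite ltr_wpDl.
pose l := e / (N + 1); have l0 : 0 < l by rewrite divr_gt0.
have lN : l * N <= e.
  by rewrite mulrAC ler_pdivrMr// ler_wpM2l ?(ltW e0)// lerDl.
pose k := 1 + l^-1; have k0 : 0 < k by rewrite ltr_wpDr// invr_ge0 ltW.
have e1 : 0 < e / 2 / k by rewrite !divr_gt0.
have [d1 d10 H1] := cr t0 M _ e1; have [d2 d20 H2] := cs t0 M _ e1.
exists (Num.min d1 d2) => [|t]; first by rewrite lt_min d10.
rewrite lt_min => /andP[/H1 h1 /H2 h2].
have [_ lr2] := lr t0; have [_ ls2] := ls t0.
have [_ ldr] := l2B (lr t) (lr t0); have [_ lds] := l2B (ls t) (ls t0).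
pose dr x := (r t x - r t0 x) ^+ 2; pose ds x := (s t x - s t0 x) ^+ 2.
apply: (@le_trans _ _ (intab (- M) M (fun x =>
    k / 2 * (dr x + ds x) + l / 2 * (r t0 x ^+ 2 + s t0 x ^+ 2)))).
  apply: le_intab.
  - by apply: lint_norm; apply: lintB; exact: l2_mul.
  - by apply: lintD; apply: lintZ; exact: lintD.
  move=> x _.
  rewrite (_ : _ - _ = (r t x - r t0 x) * (s t x - s t0 x) +
    (s t0 x * (r t x - r t0 x) + r t0 x * (s t x - s t0 x))); last by ring.
  apply: le_trans (ler_normD _ _) _.
  have h3 := amgm (r t x - r t0 x) (s t x - s t0 x) ltr01.
  have h4 := amgm (s t0 x) (r t x - r t0 x) l0.
  have h5 := amgm (r t0 x) (s t x - s t0 x) l0.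
  have h6 := ler_normD (s t0 x * (r t x - r t0 x)) (r t0 x * (s t x - s t0 x)).
  rewrite -/(dr x) -/(ds x) ?mulr1 in h3 h4 h5.
  have -> : k / 2 * (dr x + ds x) = 1 / 2 * dr x + 2^-1 * ds x + (2 * l)^-1 * (dr x + ds x).
    by rewrite /k; field; rewrite gt_eqF.
  lra.
rewrite intabD; [|by apply: lintZ; exact: lintD|by apply: lintZ; exact: lintD].
rewrite intabZ; last exact: lintD.
rewrite intabZ; last exact: lintD.
rewrite intabD// intabD// -/N.
have h3 : k / 2 * (intab (- M) M dr + intab (- M) M ds) <= k / 2 * (2 * (e / 2 / k)).
  by rewrite ler_wpM2l ?divr_ge0 ?(ltW k0)//; lra.
have h4 : k / 2 * (2 * (e / 2 / k)) = e / 2 by field; rewrite gt_eqF.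
lra.
Qed.

(** Differentiability gives continuity; the time is clipped because derivatives are known for t >= 0
    only. *)
Lemma L2loc_deriv_L2_curve (X Y : R -> R -> R) : (forall t, 0 <= t -> l2 (X t)) ->
  (forall t, 0 <= t -> l2 (Y t)) -> (forall t, 0 <= t -> L2loc_deriv X Y t) ->
  L2_curve (fun t => X (Num.max 0 t)).
Proof.
move=> lX lY dX.
have m0 t : 0 <= Num.max 0 t by rewrite le_max lexx.
split=> [t|t0 M e e0]; first exact: lX.
set s := Num.max 0 t0; have s0 : 0 <= s by exact: m0.
have [d d0 Hd] := dX s s0 M 1 ltr01.
set N := intab (- M) M (fun x => Y s x ^+ 2).
have N0 : 0 <= N by apply: intab_ge0 => x; exact: sqr_ge0.
have N1 : 0 < N + 1 by rewrite ltr_wpDl.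
exists (Num.min (Num.min 1 d) (e / (2 * (N + 1)))) => [|t].
  by rewrite !lt_min ltr01 d0 divr_gt0// mulr_gt0.
rewrite !lt_min => /andP[/andP[t1 td] te].
pose k := Num.max 0 t - s.
have kt : `|k| <= `|t - t0| by exact: dist_max0.
have -> : Num.max 0 t = s + k by rewrite addrC subrK.
have sk : 0 <= s + k by rewrite addrC subrK.
(* Distinct times may be clipped to the same one, and the quotient needs k != 0. *)
have [k0|k0] := eqVneq k 0.
  rewrite (_ : (fun x => _) = fun=> 0); last first.
    by apply/funext => x; rewrite k0 addr0 subrr expr0n.
  have [M0|M0] := ltP M 0; first by rewrite intab_gt ?(ltW e0)//; lra.
  by rewrite intab_cst ?mul0r ?(ltW e0)//; lra.
have := Hd k k0 (le_lt_trans kt td) sk.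
have [_ lq] := l2_quot k (lX _ sk) (lX _ s0) (lY _ s0).
have [_ lY2] := lY _ s0; have [_ lB2] := l2B (lX _ sk) (lX _ s0).
set q := (fun x => _ ^+ 2) in lq *; move=> h.
apply: (@le_trans _ _ (intab (- M) M (fun x => 2 * `|k| * (Y s x ^+ 2 + q x)))).
  apply: le_intab => //; first by apply: lintZ; exact: lintD.
  move=> x _.
  have -> : X (s + k) x - X s x = k * (Y s x + ((X (s + k) x - X s x) / k - Y s x)).
    by field.
  rewrite exprMn /q; set p := (_ - Y s x).
  rewrite -(real_normK (num_real k)).
  have a1 : `|k| ^+ 2 <= `|k| by rewrite expr2 ler_piMr//; lra.
  have a2 : (Y s x + p) ^+ 2 <= 2 * (Y s x ^+ 2 + p ^+ 2).
    by have := sqr_ge0 (Y s x - p); nra.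
  have := ler_pM (sqr_ge0 `|k|) (sqr_ge0 (Y s x + p)) a1 a2; lra.
rewrite intabZ; last exact: lintD.
rewrite intabD// -/N.
have h2 : 2 * `|k| * (N + intab (- M) M q) <= 2 * `|k| * (N + 1).
  by rewrite ler_wpM2l ?mulr_ge0// lerD2l.
apply: le_trans h2 _.
have h3 : `|k| <= e / (2 * (N + 1)) by rewrite (le_trans kt)// ltW.
have := ler_wpM2r (ltW N1) h3.
rewrite (_ : e / (2 * (N + 1)) * (N + 1) = e / 2); last by field; rewrite gt_eqF.
lra.
Qed.

(** Writing X(t + k) = X + k (Y + q) with q the quotient error and comparing the equal norms gives J
    = -P - (k/2) S, where P pairs X with q and S is the integral of (Y + q)^2. Both terms tend to 0
    with k. *)
Lemma constant_norm_ortho (X Y : R -> R -> R) t : 0 <= t ->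
  (forall t, 0 <= t -> l2 (X t)) -> l2 (Y t) -> L2loc_deriv X Y t ->
  (forall t, 0 <= t -> intab 0 1 (fun x => X t x ^+ 2) = 1) ->
  intab 0 1 (fun x => X t x * Y t x) = 0.
Proof.
move=> t0 lX lY dX nX.
have l1 := l2_mul (lX _ t0) lY; have [_ lX2] := lX _ t0; have [_ lY2] := lY.
set J := intab _ _ _.
set N := intab 0 1 (fun x => Y t x ^+ 2).
have N0 : 0 <= N by apply: intab_ge0 => x; exact: sqr_ge0.
apply/eqP; rewrite -normr_eq0; apply/negPn/negP => Jn.
have J0 : 0 < `|J| by rewrite lt0r Jn/=.
(* Both terms will be at most e in absolute value, so that |J| <= 2e <= |J|/2, a contradiction. *)
pose e := Num.min 1 (`|J| / 4).
have e0 : 0 < e by rewrite lt_min ltr01 divr_gt0.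
have e1 : e <= 1 by rewrite ge_min lexx.
have eJ : e <= `|J| / 4 by rewrite ge_min lexx orbT.
have e20 : 0 < e ^+ 2 by rewrite exprn_gt0.
have [d d0 Hd] := dX 1 _ e20.
pose k := Num.min (d / 2) (e / (N + 1)).
have k0 : 0 < k by rewrite lt_min !divr_gt0// ltr_wpDl.
have kd : k < d by rewrite /k gt_min ltr_pdivrMr// ltr_pMr// ltr1n.
have kN : k * (N + 1) <= e by rewrite -ler_pdivlMr ?ltr_wpDl// /k ge_min lexx orbT.
have tk : 0 <= t + k by rewrite addr_ge0// ltW.
have kn : k != 0 by rewrite gt_eqF.
have := Hd k kn; rewrite gtr0_norm// => /(_ kd tk).
have lq := l2_quot k (lX _ tk) (lX _ t0) lY; case: (lq) => _ lq2.
set q := (fun x => _ / k - Y t x) in lq lq2 *; move=> h.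
have {h} Q : intab 0 1 (fun x => q x ^+ 2) <= e ^+ 2.
  apply: le_trans h; apply: intab_sub; rewrite ?oppr_le0//.
  by move=> x; exact: sqr_ge0.
have l3 := l2_mul (lX _ t0) lq; have [_ l4] := l2D lY lq.
set P := intab 0 1 (fun x => X t x * q x).
set S := intab 0 1 (fun x => (Y t x + q x) ^+ 2).
have E : intab 0 1 (fun x => X (t + k) x ^+ 2) =
    intab 0 1 (fun x => X t x ^+ 2) + 2 * k * (J + P) + k ^+ 2 * S.
  rewrite /J /P /S -intabD// -intabZ; last exact: lintD.
  rewrite -intabZ// -intabD//; last by apply: lintZ; exact: lintD.
  rewrite -intabD//; [|by apply: lintD => //; apply: lintZ; exact: lintD|exact: lintZ].
  apply: eq_intab => x _.
  have -> : X (t + k) x = X t x + k * (Y t x + q x) by rewrite /q; field.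
  by ring.
rewrite !nX// in E.
have JE : J = - P - k / 2 * S.
  have : k * (2 * (J + P) + k * S) = 0 by lra.
  by move=> /eqP; rewrite mulf_eq0 (negbTE kn)/= => /eqP; lra.
have Pb : `|P| <= e.
  apply: le_trans (norm_intab _ _ l3) _.
  apply: (@le_trans _ _ (intab 0 1 (fun x => e / 2 * X t x ^+ 2 + (2 * e)^-1 * q x ^+ 2))).
    apply: le_intab; [exact: lint_norm|by apply: lintD; exact: lintZ|].
    by move=> x _; exact: amgm.
  rewrite intabD; [|exact: lintZ|exact: lintZ].
  rewrite !intabZ// nX// mulr1.
  have : (2 * e)^-1 * intab 0 1 (fun x => q x ^+ 2) <= (2 * e)^-1 * e ^+ 2.
    by rewrite ler_wpM2l// invr_ge0 mulr_ge0// ltW.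
  rewrite (_ : (2 * e)^-1 * e ^+ 2 = e / 2); [lra|by field; rewrite gt_eqF].
have S0 : 0 <= S by apply: intab_ge0 => x; exact: sqr_ge0.
have Sb : S <= 2 * (N + 1).
  apply: (@le_trans _ _ (intab 0 1 (fun x => 2 * (Y t x ^+ 2 + q x ^+ 2)))).
    apply: le_intab => //; first by apply: lintZ; exact: lintD.
    by move=> x _; have := sqr_ge0 (Y t x - q x); nra.
  rewrite intabZ; last exact: lintD.
  rewrite intabD// -/N.
  have : e ^+ 2 <= 1 by rewrite expr2 -[leRHS]mulr1 ler_pM// ltW.
  lra.
have kS : k / 2 * S <= e.
  have := ler_wpM2l (ltW k0) Sb; lra.
have kS0 : 0 <= k / 2 * S by rewrite mulr_ge0// divr_ge0// ltW.
have : `|J| <= 2 * e.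
  move: Pb; rewrite ler_norml => /andP[? ?].
  by rewrite ler_norml; apply/andP; split; lra.
lra.
Qed.

Definition aeq f g := forall a b, ae_eq mu (`[a, b]%classic : set (measurableTypeR R)) f g.

Lemma aeq_op (F : R -> R -> R -> R) f f' g g' : aeq f f' -> aeq g g' ->
  aeq (fun x => F x (f x) (g x)) (fun x => F x (f' x) (g' x)).
Proof.
move=> H H' a b; have := H a b; have := H' a b.
by apply: filterS2 => x h h' xab; rewrite h ?h'.
Qed.

Lemma aeq_intab f g a b : lint f -> lint g -> aeq f g -> intab a b f = intab a b g.
Proof.
move=> lf lg H; rewrite /intab /Rintegral; congr fine; apply: ae_eq_integral => //.
- by have /integrableP[] := lf a b.
- by have /integrableP[] := lg a b.
by have := H a b; apply: filterS => x h xab; rewrite h.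
Qed.

Lemma aeq_oint f g a b : lint f -> lint g -> aeq f g -> oint a b f = oint a b g.
Proof. by move=> lf lg H; rewrite /oint !(aeq_intab _ _ lf lg H). Qed.

Lemma aeq_of_sq f g : l2 f -> l2 g ->
  (forall M, intab (- M) M (fun x => (f x - g x) ^+ 2) = 0) -> aeq f g.
Proof.
move=> lf lg H a b; have [_ ld] := l2B lf lg.
have Z : (\int[mu]_(x in `[a, b]) `| (((f x - g x) ^+ 2)%R)%:E| = 0)%E.
  have : intab a b (fun x => (f x - g x) ^+ 2) = 0.
    apply/eqP; rewrite eq_le intab_ge0 ?andbT => [|x]; last exact: sqr_ge0.
    rewrite -(H (`|a| + `|b|)); apply: intab_sub => //.
    - by move=> x; exact: sqr_ge0.
    - by have := ler_norm (- a); rewrite normrN; have := normr_ge0 b; lra.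
    - by have := ler_norm b; have := normr_ge0 a; lra.
  rewrite /intab /Rintegral => h.
  have fi : (\int[mu]_(x in `[a, b]) ((f x - g x) ^+ 2)%:E)%E \is a fin_num.
    by apply: integrable_fin_num => //; exact: ld.
  transitivity (\int[mu]_(x in `[a, b]) ((f x - g x) ^+ 2)%:E)%E.
    by apply: eq_integral => x _; rewrite /= ger0_norm// sqr_ge0.
  by rewrite -(fineK fi) h.
have mf : measurable_fun `[a, b] (EFin \o (fun x => (f x - g x) ^+ 2)).
  by have /integrableP[] := ld a b.
have mab : measurable (`[a, b]%classic : set (measurableTypeR R)) by [].
have /(ae_eq_integral_abs mu mab mf) := Z.
apply: filterS => x h xab.
have := h xab => -[/eqP]; rewrite sqrf_eq0 subr_eq0 => /eqP; exact.
Qed.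

End L2Curves.

(** * The coefficient (G^2 - F)/2 of the linear equation *)

Section Potential.
Variable R : realType.
Implicit Types (d e t x y m sg : R) (f g h r s : R -> R).

Definition qf r x := oint 0 x (fun y => r y ^+ 2).
Definition wgt m r s y := r y ^+ 2 * Gop m r s y ^+ 2 + 2 * s y ^+ 2.
Definition expw sg m r s y := expR (sg * qf r y) * wgt m r s y.
Definition Wf sg m r s x := oint 0 x (expw sg m r s).

(* The kernel of [Fop] splits as a sum of products e^{+-q(x)} e^{-+q(y)} on both sides
   of y = x; this closed form extends [Fop m r s] from [0, 1] to a 1-periodic function,
   which [Fop] itself is not. *)
Definition Fext m r s x := 1 / 2 / (2 * sinhR (1 / 2)) *
  (expR (qf r x - 1 / 2) * Wf (-1) m r s x + expR (1 / 2 - qf r x) * Wf 1 m r s x +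
   expR (- qf r x - 1 / 2) * (Wf 1 m r s 1 - Wf 1 m r s x) +
   expR (qf r x + 1 / 2) * (Wf (-1) m r s 1 - Wf (-1) m r s x)).

Definition pot m r s x := 1 / 2 * (Gop m r s x ^+ 2 - Fext m r s x).

(** A single function is a constant curve in L^1. *)
Lemma lint_oint_cont f : lint f -> continuous (fun x => oint 0 x f).
Proof.
move=> lf; have h : L1_curve (fun _ : R => f).
  split=> // t0 M e e0; exists 1 => // t _.
  rewrite (_ : (fun x => _) = fun=> 0); last first.
    by apply/funext => x; rewrite subrr normr0.
  have [M0|M0] := ltP M 0; first by rewrite intab_gt ?(ltW e0)//; lra.
  by rewrite intab_cst ?mul0r ?(ltW e0)//; lra.
exact: jcont2 0 (L1_curve_oint h).
Qed.

Lemma l2_mul2 r s : l2 r -> l2 s -> lint (fun y => 2 * r y * s y).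
Proof.
move=> lr ls; rewrite (_ : (fun y => _) = fun y => 2 * (r y * s y)).
  by apply: lintZ; exact: l2_mul.
by apply/funext => y; rewrite mulrA.
Qed.

Lemma Gop_cont m r s : l2 r -> l2 s -> continuous (Gop m r s).
Proof.
move=> lr ls; rewrite /Gop; set k := intab _ _ _ => x.
apply: (@continuousB _ R R (fun x => oint 0 x (fun y => 2 * r y * s y) + m) (cst k)); last first.
  exact: cst_continuous.
apply: (@continuousD _ R R (fun x => oint 0 x (fun y => 2 * r y * s y)) (cst m)); last first.
  exact: cst_continuous.
exact/lint_oint_cont/l2_mul2.
Qed.

Lemma continuous_sqr f : continuous f -> continuous (fun x => f x ^+ 2).
Proof.
move=> cf x.
by apply: (@continuous_comp _ _ _ f (fun y => y ^+ 2)); [exact: cf|exact: exprn_continuous].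
Qed.

Lemma continuous_exp f : continuous f -> continuous (fun x => expR (f x)).
Proof.
move=> cf x.
by apply: (@continuous_comp _ _ _ f expR); [exact: cf|exact: continuous_expR].
Qed.

Lemma lint_wgt m r s : l2 r -> l2 s -> lint (wgt m r s).
Proof.
move=> lr ls; have cG := @Gop_cont m r s lr ls; case: lr ls => _ lr [_ ls].
rewrite (_ : wgt m r s = fun y => Gop m r s y ^+ 2 * r y ^+ 2 + 2 * s y ^+ 2).
  apply: lintD; last exact: lintZ.
  by apply: lint_mulc => //; exact: continuous_sqr.
by apply/funext => y; rewrite /wgt (mulrC (r y ^+ 2)).
Qed.

Lemma qf_cont r : l2 r -> continuous (qf r).
Proof. by move=> [_ lr]; exact: lint_oint_cont. Qed.

Lemma lint_expw sg m r s : l2 r -> l2 s -> lint (expw sg m r s).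
Proof.
move=> lr ls; apply: lint_mulc; last exact: lint_wgt.
apply: continuous_exp => x.
by apply: (@continuousM R R (cst sg) (qf r)); [exact: cst_continuous|exact: qf_cont].
Qed.

Lemma qf_sub r x y : l2 r -> oint y x (fun z => r z ^+ 2) = qf r x - qf r y.
Proof.
by move=> [_ lr]; rewrite /qf (oint_split 0 y x lr) (ointC y); ring.
Qed.

Lemma qf_homo r x y : l2 r -> x <= y -> qf r x <= qf r y.
Proof.
move=> lr xy; rewrite -subr_ge0 -qf_sub// /oint xy.
by apply: intab_ge0 => z; exact: sqr_ge0.
Qed.

(** Separates the variables of the kernel: p depends on x alone, q on y alone. *)
Lemma coshR_split (c p q u w p' q' : R) : u = p - q -> p' = - p -> q' = - q ->
  coshR u / c * w = 1 / 2 / c * expR p * (expR q' * w) + 1 / 2 / c * expR p' * (expR q * w).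
Proof.
move=> -> -> ->; rewrite /coshR opprB addrC !expRD.
by move: (expR p) (expR q) (expR (- p)) (expR (- q)) c^-1 => *; ring.
Qed.

(** [qf r] is nondecreasing, so for x in [0, 1] the absolute value in the kernel has a fixed sign on
    [0, x] and on [x, 1]; on each side the kernel separates into exponentials. *)
Lemma Fop_Fext m r s x : l2 r -> l2 s -> 0 <= x <= 1 -> Fop m r s x = Fext m r s x.
Proof.
move=> lr ls /andP[x0 x1]; have lw := @lint_wgt m r s lr ls.
have lp := @lint_expw 1 m r s lr ls; have lm := @lint_expw (-1) m r s lr ls.
have Ep y : expw 1 m r s y = expR (qf r y) * wgt m r s y by rewrite /expw mul1r.
have Em y : expw (-1) m r s y = expR (- qf r y) * wgt m r s y by rewrite /expw mulN1r.
rewrite /Fop.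
set c := 2 * sinhR (1 / 2).
have -> : (fun y => coshR (`|oint y x (fun z => r z ^+ 2)| - 1 / 2) / c *
    (r y ^+ 2 * Gop m r s y ^+ 2 + 2 * s y ^+ 2)) =
    (fun y => coshR (`|qf r x - qf r y| - 1 / 2) / c * wgt m r s y).
  by apply/funext => y; rewrite qf_sub.
have lF : lint (fun y => coshR (`|qf r x - qf r y| - 1 / 2) / c * wgt m r s y).
  apply: lint_mulc => //.
  have cq : continuous (fun y => `|qf r x - qf r y| - 1 / 2).
    move=> y; apply: (@continuousB _ R R (fun y => `|qf r x - qf r y|) (cst (1 / 2))).
      apply: (@continuous_comp _ _ _ (fun y => qf r x - qf r y) (fun z => `|z|)).
        apply: (@continuousB _ R R (cst (qf r x)) (qf r)); first exact: cst_continuous.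
        exact: qf_cont.
      exact: norm_continuous.
    exact: cst_continuous.
  rewrite /coshR => y.
  apply: (@continuousM R R (fun y => (expR (`|qf r x - qf r y| - 1 / 2) +
    expR (- (`|qf r x - qf r y| - 1 / 2))) / 2) (cst c^-1)); last exact: cst_continuous.
  apply: (@continuousM R R (fun y => expR (`|qf r x - qf r y| - 1 / 2) +
    expR (- (`|qf r x - qf r y| - 1 / 2))) (cst 2^-1)); last exact: cst_continuous.
  apply: (@continuousD _ R R (fun y => expR (`|qf r x - qf r y| - 1 / 2))).
    exact: continuous_exp.
  apply: continuous_exp => z.
  by apply: (@continuousN _ R R (fun y => `|qf r x - qf r y| - 1 / 2)); exact: cq.
rewrite (intab_split lF x0 x1).
have -> : intab 0 x (fun y => coshR (`|qf r x - qf r y| - 1 / 2) / c * wgt m r s y) =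
    intab 0 x (fun y => 1 / 2 / c * expR (qf r x - 1 / 2) * expw (-1) m r s y +
      1 / 2 / c * expR (1 / 2 - qf r x) * expw 1 m r s y).
  apply: eq_intab => y /andP[_ yx].
  rewrite ger0_norm ?subr_ge0 ?qf_homo// Ep Em.
  by apply: coshR_split; rewrite ?opprB//; ring.
have -> : intab x 1 (fun y => coshR (`|qf r x - qf r y| - 1 / 2) / c * wgt m r s y) =
    intab x 1 (fun y => 1 / 2 / c * expR (- qf r x - 1 / 2) * expw 1 m r s y +
      1 / 2 / c * expR (qf r x + 1 / 2) * expw (-1) m r s y).
  apply: eq_intab => y /andP[xy _].
  rewrite ler0_norm ?subr_le0 ?qf_homo// Ep Em.
  by apply: coshR_split; rewrite ?opprK//; ring.
rewrite intabD; [|exact: lintZ|exact: lintZ].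
rewrite intabD; [|exact: lintZ|exact: lintZ].
rewrite !intabZ// /Fext -/c !intab_oint// -!/(Wf _ _ _ _ _).
have e sg : oint x 1 (expw sg m r s) = Wf sg m r s 1 - Wf sg m r s x.
  have l := @lint_expw sg m r s lr ls.
  by rewrite /Wf (oint_split 0 x 1 l) (ointC x); ring.
rewrite !e; move: (Wf _ _ _ _ _) (Wf _ _ _ _ _) (expR _) (expR _) (expR _) (expR _) c^-1 => *; ring.
Qed.

Lemma fop_pot m r s x : l2 r -> l2 s -> 0 <= x <= 1 -> fop m r s x = pot m r s x * r x.
Proof. by move=> lr ls x01; rewrite /fop /pot Fop_Fext//; ring. Qed.

Lemma oint_step f x : lint f ->
  oint 0 (x + 1) f = oint 0 1 f + oint 0 x (fun y => f (y + 1)).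
Proof.
move=> lf; rewrite (oint_split 1 0 (x + 1) lf).
by have := oint_shift 0 x 1 lf; rewrite add0r => ->.
Qed.

(** Unit norm gives q(x + 1) = q(x) + 1 and orthogonality gives the periodicity of G, so W(x + 1) =
    W(1) + e^{sg} W(x). Inserted in [Fext], the factors e^{sg} cancel against the shifted exponents,
    and the contributions of the two sides of y = x recombine. *)
Lemma pot_periodic m r s : l2 r -> l2 s -> periodic1 r -> periodic1 s ->
  intab 0 1 (fun x => r x ^+ 2) = 1 -> intab 0 1 (fun x => r x * s x) = 0 ->
  periodic1 (pot m r s).
Proof.
move=> lr ls pr ps nr os; have [_ lr2] := lr.
have qS x : qf r (x + 1) = qf r x + 1.
  rewrite /qf oint_step// -intab_oint ?ler01// nr addrC; congr (_ + _).
  by apply: eq_oint => y; rewrite pr.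
have lrs := l2_mul2 lr ls.
have GS x : Gop m r s (x + 1) = Gop m r s x.
  rewrite /Gop oint_step// -(intab_oint (a := 0) (b := 1)) ?ler01//.
  have -> : intab 0 1 (fun y => 2 * r y * s y) = 0.
    rewrite (_ : (fun y => _) = fun y => 2 * (r y * s y)).
      by rewrite intabZ ?os ?mulr0//; exact: l2_mul.
    by apply/funext => y; rewrite mulrA.
  by rewrite add0r; congr (_ + _ - _); apply: eq_oint => y; rewrite pr ps.
have WS sg x : Wf sg m r s (x + 1) = Wf sg m r s 1 + expR sg * Wf sg m r s x.
  rewrite /Wf oint_step; last exact: lint_expw.
  rewrite -(ointZ _ _ _ (@lint_expw sg m r s lr ls)); congr (_ + _).
  apply: eq_oint => y; rewrite /expw qS (_ : sg * (qf r y + 1) = sg * qf r y + sg); last by ring.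
  by rewrite expRD /wgt pr ps GS; move: (expR _) (expR _) => *; ring.
move=> x; rewrite /pot GS; congr (_ * (_ - _)).
rewrite /Fext; congr (_ * _); rewrite qS !WS.
set W1 := Wf 1 m r s x; set W2 := Wf (-1) m r s x.
set V1 := Wf 1 m r s 1; set V2 := Wf (-1) m r s 1.
set q := qf r x.
(* Exponents are broken into q and halves, so that the identity becomes rational in e^q and
   e^{1/2}. *)
rewrite (_ : q + 1 - 1 / 2 = q + 1 / 2); last by field.
rewrite (_ : 1 / 2 - (q + 1) = - q - 1 / 2); last by field.
rewrite (_ : - (q + 1) - 1 / 2 = - q - 1 / 2 - 1 / 2 - 1 / 2); last by field.
rewrite (_ : q + 1 + 1 / 2 = q + 1 / 2 + 1 / 2 + 1 / 2); last by field.
rewrite [in expR 1](splitr 1) [in expR (-1)](_ : -1 = - (1 / 2) - 1 / 2); last by field.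
rewrite !expRD !expRN !div1r.
have a0 : expR (2^-1 : R) != 0 by rewrite gt_eqF ?expR_gt0.
have b0 : expR q != 0 by rewrite gt_eqF ?expR_gt0.
by field; rewrite ?a0 ?b0.
Qed.

(** r and s occur only under integrals in x and only in products of two, which are continuous curves
    in L^1; the remaining factors are jointly continuous. *)
Lemma pot_jcont m (r s : R -> R -> R) : L2_curve r -> L2_curve s ->
  jcont (fun t x => pot m (r t) (s t) x).
Proof.
move=> cr cs.
have crr : L1_curve (fun t y => r t y ^+ 2) by exact: L2_curve_mul.
have css : L1_curve (fun t y => s t y ^+ 2) by exact: L2_curve_mul.
have crs : L1_curve (fun t y => 2 * r t y * s t y).
  rewrite (_ : (fun _ _ => _) = fun t y => 2 * (r t y * s t y)).
    by apply: L1_curve_mulc; [exact: jcont_cst|exact: L2_curve_mul].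
  by apply/funext => t; apply/funext => y; rewrite mulrA.
have cI (f : R -> R -> R) : L1_curve f -> jcont (fun t _ => oint 0 1 (f t)).
  by move=> cf; apply: (jcont_time (h := fun t => oint 0 1 (f t))); exact: jcont1 1 (L1_curve_oint cf).
have cG : jcont (fun t x => Gop m (r t) (s t) x).
  rewrite /Gop; apply: jcontB.
    by apply: jcontD; [exact: L1_curve_oint|exact: jcont_cst].
  rewrite (_ : (fun _ _ => _) = fun t x =>
      oint 0 1 (fun y => oint 0 y (fun z => 2 * r t z * s t z) * r t y ^+ 2)).
    by apply: cI; apply: L1_curve_mulc => //; exact: L1_curve_oint.
  by apply/funext => t; apply/funext => x; rewrite intab_oint.
have cq : jcont (fun t x => qf (r t) x) by exact: L1_curve_oint.
have cw : L1_curve (fun t x => wgt m (r t) (s t) x).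
  rewrite (_ : (fun _ _ => _) = fun t y => Gop m (r t) (s t) y ^+ 2 * r t y ^+ 2 + 2 * s t y ^+ 2).
    apply: L1_curveD; last by apply: L1_curve_mulc => //; exact: jcont_cst.
    by apply: L1_curve_mulc => //; exact: jcontM.
  by apply/funext => t; apply/funext => y; rewrite /wgt (mulrC (r t y ^+ 2)).
have cE sg : L1_curve (fun t x => expw sg m (r t) (s t) x).
  apply: L1_curve_mulc => //; apply: jcont_exp; apply: jcontM => //; exact: jcont_cst.
have cW sg : jcont (fun t x => Wf sg m (r t) (s t) x) by exact: L1_curve_oint.
have cW1 sg : jcont (fun t x => Wf sg m (r t) (s t) 1) by exact: cI.
have ck (k : R) : jcont (fun _ _ => k) by exact: jcont_cst.
have cN : jcont (fun t x => - qf (r t) x).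
  rewrite (_ : (fun _ _ => _) = fun t x => 0 - qf (r t) x); first exact: jcontB.
  by apply/funext => t; apply/funext => x; rewrite sub0r.
apply: jcontM => //; apply: jcontB; first exact: jcontM.
apply: jcontM => //; apply: jcontD; last first.
  by apply: jcontM; [apply: jcont_exp; exact: jcontD|exact: jcontB].
apply: jcontD; last first.
  by apply: jcontM; [apply: jcont_exp; exact: jcontB|exact: jcontB].
by apply: jcontD; apply: jcontM => //; apply: jcont_exp; exact: jcontB.
Qed.

Lemma smooth_oint j (f : R -> R -> R) : smooth j f -> smooth j.+1 (fun t x => oint 0 x (f t)).
Proof.
move=> sf; have cf := smooth_jcont sf; split; first exact/L1_curve_oint/jcont_L1_curve.
by exists f => // t x; apply: is_derive_oint; exact: jcont2.
Qed.

Lemma smooth_oint1 j (f : R -> R -> R) : jcont f -> smooth j (fun t x => oint 0 1 (f t)).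
Proof.
move=> cf; apply: (smooth_time j (h := fun t => oint 0 1 (f t))).
exact: jcont1 1 (L1_curve_oint (jcont_L1_curve cf)).
Qed.

(** The densities are needed only at order j, since everything built from them is a primitive in x
    or a constant in x. *)
Lemma pot_smooth j m (r s : R -> R -> R) : smooth j r -> smooth j s ->
  smooth j.+1 (fun t x => pot m (r t) (s t) x).
Proof.
move=> cr cs.
have crr : smooth j (fun t y => r t y ^+ 2) by exact: smoothM.
have css : smooth j (fun t y => s t y ^+ 2) by exact: smoothM.
have crs : smooth j (fun t y => 2 * r t y * s t y).
  by apply: smoothM => //; exact: smoothZ.
have cG : smooth j.+1 (fun t x => Gop m (r t) (s t) x).
  rewrite /Gop; apply: smoothB.
    by apply: smoothD; [exact: smooth_oint|exact: smooth_cst].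
  rewrite (_ : (fun _ _ => _) = fun t x =>
      oint 0 1 (fun y => oint 0 y (fun z => 2 * r t z * s t z) * r t y ^+ 2)).
    apply: (@smooth_oint1 _ (fun t y => oint 0 y (fun z => 2 * r t z * s t z) * r t y ^+ 2)).
    by apply: jcontM; [exact: smooth_jcont (smooth_oint crs)|exact: smooth_jcont crr].
  by apply/funext => t; apply/funext => x; rewrite intab_oint.
have cq : smooth j.+1 (fun t x => qf (r t) x) by exact: smooth_oint.
have cw : smooth j (fun t x => wgt m (r t) (s t) x).
  apply: smoothD; last exact: smoothZ.
  apply: smoothM => //; have := smoothW cG => h; exact: smoothM.
have cE sg : smooth j (fun t x => expw sg m (r t) (s t) x).
  by apply: smoothM => //; apply: smooth_exp; apply: smoothZ; exact: smoothW.
have cW sg : smooth j.+1 (fun t x => Wf sg m (r t) (s t) x) by exact: smooth_oint.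
have cW1 sg : smooth j.+1 (fun t x => Wf sg m (r t) (s t) 1).
  by apply: smooth_oint1; exact: smooth_jcont (cE sg).
have ck (k : R) : smooth j.+1 (fun _ _ => k) by exact: smooth_cst.
have cN : smooth j.+1 (fun t x => - qf (r t) x).
  rewrite (_ : (fun _ _ => _) = fun t x => 0 - qf (r t) x); first exact: smoothB.
  by apply/funext => t; apply/funext => x; rewrite sub0r.
apply: smoothM => //; apply: smoothB; first exact: smoothM.
apply: smoothM => //; apply: smoothD; last first.
  by apply: smoothM; [apply: smooth_exp; exact: smoothD|exact: smoothB].
apply: smoothD; last first.
  by apply: smoothM; [apply: smooth_exp; exact: smoothB|exact: smoothB].
by apply: smoothD; apply: smoothM => //; apply: smooth_exp; exact: smoothB.
Qed.

(** The equality holds at every point, because r and s occur only under integrals. This lets the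
    coefficient, defined from rho and rho_t, inherit the regularity of their smooth
    representatives. *)
Lemma pot_aeq m r s r' s' : l2 r -> l2 s -> l2 r' -> l2 s' -> aeq r r' -> aeq s s' ->
  pot m r s = pot m r' s'.
Proof.
move=> lr ls lr' ls' er es.
have [_ lr2] := lr; have [_ lr2'] := lr'.
have er2 : aeq (fun y => r y ^+ 2) (fun y => r' y ^+ 2).
  exact: (aeq_op (fun _ p _ => p ^+ 2) er es).
have lrs := l2_mul2 lr ls; have lrs' := l2_mul2 lr' ls'.
have E x : oint 0 x (fun y => 2 * r y * s y) = oint 0 x (fun y => 2 * r' y * s' y).
  by apply: aeq_oint => //; exact: (aeq_op (fun _ p q => 2 * p * q) er es).
have EG : Gop m r s = Gop m r' s'.
  apply/funext => x; rewrite /Gop E; congr (_ - _).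
  have c f : lint f -> continuous (fun y => oint 0 y f) by exact: lint_oint_cont.
  under eq_intab => y _ do rewrite E.
  apply: aeq_intab; [by apply: lint_mulc => //; exact: c|by apply: lint_mulc => //; exact: c|].
  exact: (aeq_op (fun y p _ => oint 0 y (fun y => 2 * r' y * s' y) * p ^+ 2) er es).
have Eq : qf r = qf r' by apply/funext => x; exact: aeq_oint.
have EW sg x : Wf sg m r s x = Wf sg m r' s' x.
  apply: aeq_oint; [exact: lint_expw|exact: lint_expw|].
  rewrite /expw /wgt Eq EG.
  exact: (aeq_op (fun y p q => expR (sg * qf r' y) * (p ^+ 2 * Gop m r' s' y ^+ 2 + 2 * q ^+ 2)) er es).
by apply/funext => x; rewrite /pot /Fext EG Eq !EW.
Qed.

End Potential.

(** * Absolute continuity of primitives, classical C^k regularity, initial data *)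

Section Main.
Variable R : realType.
Notation mu := (@lebesgue_measure R).
Implicit Types (d e t x y : R) (f g h : R -> R).

(** For f >= 0 the sum of increments is the integral of f over the union of the intervals, a set
    whose measure is their total length. *)
Lemma abs_cont_oint f a b k : lint f -> (forall x, 0 <= f x) ->
  abs_cont_on a b (fun x => oint 0 x f + k).
Proof.
move=> lf f0 e e0; have [d d0 Hd] := lint_small a b lf e0.
exists d => // n x y xy dis sd.
(* Open intervals, as the closed ones may share endpoints. *)
pose A (i : 'I_n) := `]x i, y i[%classic : set (measurableTypeR R).
have mA i : measurable (A i) by exact: measurable_itv.
have tA : trivIset [set` index_enum 'I_n] A.
  apply/trivIsetP => i j _ _ ij; apply/seteqP; split=> // z [].
  rewrite /A /= !in_itv/= => /andP[h1 h2] /andP[h3 h4].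
  have [|h5|h5] := dis i j (ltn_ord i) (ltn_ord j); last 2 first.
  - by have := lt_trans h3 (lt_le_trans h2 h5); rewrite ltxx.
  - by have := lt_trans h1 (lt_le_trans h4 h5); rewrite ltxx.
  by move=> h5; move/eqP: ij; apply; exact: val_inj.
pose U := \big[setU/set0]_(i <- index_enum 'I_n) A i.
have mU : measurable U by exact: bigsetU_measurable.
have Uab : U `<=` `[a, b].
  rewrite /U => z; rewrite -bigcup_seq => -[i _].
  have [h1 [h2 h3]] := xy i (ltn_ord i).
  rewrite /A /= !in_itv/= => /andP[h4 h5]; apply/andP; split.
    exact: ltW (le_lt_trans h1 h4).
  exact: ltW (lt_le_trans h5 h3).
have muU : (mu U < d%:E)%E.
  have -> : mu U = (\sum_(i <- index_enum 'I_n) mu (A i))%E.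
    rewrite /U measure_bigsetU_ord// => i j _ _.
    exact: (tA i j (mem_index_enum i) (mem_index_enum j)).
  rewrite (eq_bigr (fun i : 'I_n => (y i - x i)%:E)) => [|i _]; last first.
    rewrite /A lebesgue_measure_itv/= lte_fin; have [_ [h2 _]] := xy i (ltn_ord i).
    by case: ltgtP h2 => // -> _; rewrite subrr.
  by rewrite sumEFin lte_fin.
apply: le_lt_trans (Hd U mU Uab muU).
have iA i : mu.-integrable (A i) (EFin \o (fun z => `|f z|)).
  apply: integrableS (lint_norm lf (x i) (y i)) => //.
  exact: subset_itv_oo_cc.
have -> : \int[mu]_(z in U) `|f z| = \sum_(i < n) \int[mu]_(z in A i) `|f z|.
  rewrite /Rintegral (ge0_integral_bigsetU _ mA (index_enum_uniq _) tA).
  - rewrite (eq_bigr (fun i => (\int[mu]_(z in A i) `|f z|)%R%:E)) => [|i _].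
      by rewrite sumEFin.
    by rewrite /Rintegral fineK//; apply: integrable_fin_num => //; exact: iA.
  - apply: (measurable_funS (measurable_itv `[a, b])) => //.
    by apply/measurable_EFinP; apply: lint_meas; exact: lint_norm.
  - by move=> z _; rewrite lee_fin.
rewrite le_eqVlt; apply/orP; left; apply/eqP; apply: eq_bigr => i _.
have [_ [h2 _]] := xy i (ltn_ord i).
rewrite opprD addrACA subrr addr0.
have -> : oint 0 (y i) f - oint 0 (x i) f = intab (x i) (y i) f.
  by rewrite intab_oint// (oint_split 0 (x i) (y i) lf) (ointC (x i)); ring.
rewrite ger0_norm; last exact: intab_ge0.
rewrite /A Rintegral_itv_bndo_bndc; last exact: iA.
rewrite Rintegral_itv_obnd_cbnd; last first.
  by apply: integrableS (lint_norm lf (x i) (y i)) => //; exact: subset_itv_oc_cc.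
by apply: eq_intab => z _; rewrite ger0_norm.
Qed.

Lemma smooth_le i j (f : R -> R -> R) : (i <= j)%N -> smooth j f -> smooth i f.
Proof.
by elim: j => [|j IHj]; rewrite leq_eqVlt => /predU1P[->//|]// ij /smoothW; exact: IHj.
Qed.

Lemma smooth_clip j (f : R -> R -> R) : smooth j f -> smooth j (fun t => f (Num.max 0 t)).
Proof.
elim: j f => [|j IHj] f [cf sf]; split=> //; try exact: jcont_clip.
by case: sf => f' df sf'; exists (fun t => f' (Num.max 0 t)) => //; exact: IHj.
Qed.

Lemma smooth_Ck k (f : R -> R -> R) t : smooth k f -> Ck k (f t).
Proof.
elim: k f => [|k IHk] f; first by move=> [cf _]; split=> //; exact: jcont2.
move=> [_ [f' df /IHk[d1 d2]]].
have e : derive1 (f t) = f' t.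
  by apply/funext => x; have := df t x => ?; rewrite derive1E derive_val.
split; last by rewrite derive1Sn e.
move=> [|i] ik x; first by have := df t x => -[].
by rewrite derive1Sn e; exact: d1.
Qed.

Lemma Ck_continuous k f i : Ck k f -> (i <= k)%N -> continuous (derive1n i f).
Proof.
move=> [d c]; rewrite leq_eqVlt => /predU1P[->//|ik] x.
exact/differentiable_continuous/derivable1_diffP/d.
Qed.

Lemma is_derive_derive1 f x : derivable f x 1 -> is_derive x 1 f (derive1 f x).
Proof. by move=> df; rewrite derive1E; exact/derivableP. Qed.

Lemma continuous_half f : continuous f -> continuous (fun x => f x / 2).
Proof.
move=> cf x; apply: (@continuousM R R f (cst 2^-1)); [exact: cf|exact: cst_continuous].
Qed.

Lemma Ck_smooth_half j f : Ck j.+1 f -> smooth j (fun _ x => derive1 f x / 2).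
Proof.
move=> Cf; have [df _] := Cf.
apply: (smooth_space (h := fun i x => derive1n i.+1 f x / 2)) => [i ij|i x ij].
  by apply: continuous_half; exact: (Ck_continuous Cf).
have := is_derive_derive1 (df i.+1 ij x) => h.
rewrite (_ : (fun _ => _) = derive1n i.+1 f * cst 2^-1); last by apply/funext.
apply: is_derive_eq; rewrite /GRing.scale/= -derive1nS; ring.
Qed.

(* Lebesgue's differentiation theorem applied to the vanishing primitive. *)
Lemma aeq_of_oint f : lint f -> (forall x y, oint x y f = 0) -> aeq f (fun=> 0).
Proof.
move=> lf H a b.
(* Differentiation is available strictly to the right of the base point; starting at a - 1 includes
   a. *)
pose D : set (measurableTypeR R) := `[a - 1, b]%classic.
have mD : measurable D by exact: measurable_itv.
have iD : mu.-integrable setT (EFin \o (f \_ D)).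
  by rewrite -restrict_EFin; apply: (@integrable_mkcond _ _ _ mu D _ _).1 => //; exact: lf.
have h1 : forall y, mu.-integrable [set` Interval (BLeft (a - 1)) (BRight y)] (EFin \o f \_ D).
  by move=> y; apply: integrableS iD.
have h0 := FTC1 h1 (integrable_locally mD (lf _ _)).
have : {ae mu, forall x, a - 1 < x -> 0 = (f \_ D) x}.
  move: h0; apply: filterS; first exact: (ae_filter_ringOfSetsType mu).
  move=> x h ax; have [|_ <-] := h; first by rewrite /= lte_fin.
  rewrite (_ : (fun _ => _) = cst 0) ?derive1_cst//.
  apply/funext => z; rewrite -Rintegral_mkcondr.
  rewrite (_ : _ `&` _ = `[a - 1, Num.min z b]%classic).
    have [h2|h2] := leP (a - 1) (Num.min z b).
      by have := H (a - 1) (Num.min z b); rewrite -intab_oint.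
    by have := intab_gt f h2.
  apply/seteqP; split=> w; rewrite /D /= !in_itv/= le_min.
    by move=> [/andP[h2 h3] /andP[_ h4]]; rewrite h2 h3 h4.
  by move=> /and3P[h2 h3 h4]; rewrite h2 h3 h4.
apply: filterS; first exact: (ae_filter_ringOfSetsType mu).
move=> x h xab; move: (xab); rewrite /= in_itv/= => /andP[ax xb].
have := h; rewrite patchE mem_set => [->//|]; last first.
  by rewrite /D /= in_itv/= xb andbT; lra.
by lra.
Qed.

Lemma L2loc_deriv_eq (X Y Y' : R -> R -> R) t : Y t =1 Y' t -> L2loc_deriv X Y t -> L2loc_deriv X Y' t.
Proof. by move=> /funext e; rewrite /L2loc_deriv e. Qed.

Lemma L2_curve_const f : l2 f -> L2_curve (fun _ : R => f).
Proof.
move=> lf; split=> // t0 M e e0; exists 1 => // t _.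
rewrite (_ : (fun x => _) = fun=> 0); last by apply/funext => x; rewrite subrr expr0n.
have [M0|M0] := ltP M 0; first by rewrite intab_gt ?(ltW e0)//; lra.
by rewrite intab_cst ?mul0r ?(ltW e0)//; lra.
Qed.

Lemma pot_cont m f g : l2 f -> l2 g -> continuous (pot m f g).
Proof. by move=> lf lg; exact: jcont2 0 (pot_jcont m (L2_curve_const lf) (L2_curve_const lg)). Qed.

(** [psi] is phi_t, read off the integral equation; phi and [psi] are primitives of jointly
    continuous functions, hence differentiable in L^2_loc. *)
Lemma volterra_L2loc_deriv A (b : R -> R) phi : jcont A -> continuous b -> jcont phi ->
  volterra A (fun t x => 1 + t * b x) phi ->
  let psi := fun t x => b x + vprim (fun t x => A t x * phi t x) t x in
  forall t, 0 <= t -> L2loc_deriv phi psi t /\ L2loc_deriv psi (fun t x => A t x * phi t x) t.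
Proof.
move=> cA cb cphi V psi t t0; have cAp := jcontM cA cphi.
have cpsi : jcont psi by apply: jcontD; [exact: jcont_space|exact: jcont_vprim].
split; last exact: (L2loc_deriv_prim t0 cpsi cAp).
apply: (L2loc_deriv_prim (c := fun=> 1) t0 cphi cpsi) => s x s0.
rewrite V -addrA; congr (_ + _); rewrite /vprim (primD _ (@lint_cst _ (b x))); last first.
  by apply: lint_cont; exact: (jcont1 (x := x) (jcont_vprim cAp)).
by congr (_ + _); rewrite /prim intab_cst// subr0 mulrC.
Qed.

End Main.

(** * Regularity of the solution of the Cauchy problem and of the flow *)

Section Solution.
Variable R : realType.
Implicit Types (e t x M : R) (rho rhot : R -> R -> R).

Lemma L2norm_periodic f M : periodic1 f -> l2 f -> L2norm f = 0 ->
  intab (- M) M (fun x => f x ^+ 2) = 0 :> R.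
Proof.
move=> pf [_ lf2] /L2norm_eq0 h; have [K _ HK] := periodic_intab_le M.
apply/eqP; rewrite eq_le intab_ge0 ?andbT => [|x]; last exact: sqr_ge0.
have := HK (fun x => f x ^+ 2) _ lf2 _ _ _ (lexx _) (lexx _).
rewrite h mulr0; apply=> x; [by rewrite pf|exact: sqr_ge0].
Qed.

Variables (m : R) (rho rhot : R -> R -> R).
Hypothesis Hrp : forall t, 0 <= t -> periodic1 (rho t) /\ periodic1 (rhot t).
Hypothesis Hr2 : forall t, 0 <= t -> inL2 (rho t) /\ inL2 (rhot t).
Hypothesis Hode1 : forall t, 0 <= t -> L2_deriv_at rho rhot t.
Hypothesis Hode2 : forall t, 0 <= t ->
  L2_deriv_at rhot (fun s => fop m (rho s) (rhot s)) t.
Hypothesis Hnorm : forall t, 0 <= t -> intab 0 1 (fun x => rho t x ^+ 2) = 1.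

Let lr t : 0 <= t -> l2 (rho t).
Proof. by move=> t0; apply: inL2_l2; [case: (Hrp t0)|case: (Hr2 t0)]. Qed.

Let ls t : 0 <= t -> l2 (rhot t).
Proof. by move=> t0; apply: inL2_l2; [case: (Hrp t0)|case: (Hr2 t0)]. Qed.

Let P t := pot m (rho t) (rhot t).
(** The solution is controlled for t >= 0 only, while the Volterra equation asks for a coefficient
    continuous on the plane. *)
Let A t x := P (Num.max 0 t) x.

Let lPr t : 0 <= t -> l2 (fun x => P t x * rho t x).
Proof. by move=> t0; apply: l2_mulc; [apply: pot_cont|]; auto. Qed.

Let dr t : 0 <= t -> L2loc_deriv rho rhot t.
Proof.
move=> t0; apply: L2_deriv_L2loc_deriv => //; [|by case: (Hrp t0)|exact: ls|exact: Hode1].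
by move=> s s0; split; [case: (Hrp s0)|exact: lr].
Qed.

(** The hypothesis on rho_t is a statement on [0, 1], where [fop] equals P rho. The latter is
    periodic, thanks to the orthogonality of rho and rho_t, so the derivative holds in L^2_loc of
    the line. *)
Let ds t : 0 <= t -> L2loc_deriv rhot (fun t x => P t x * rho t x) t.
Proof.
move=> t0; have [pr ps] := Hrp t0.
have os := constant_norm_ortho t0 lr (ls t0) (dr t0) Hnorm.
have pP := pot_periodic m (lr t0) (ls t0) pr ps (Hnorm t0) os.
apply: L2_deriv_L2loc_deriv => //.
- by move=> s s0; split; [case: (Hrp s0)|exact: ls].
- by move=> x; rewrite /P pP pr.
- exact: lPr.
move=> e e0; have [d d0 Hd] := Hode2 t0 e0; exists d => // h h0 hd th.
have := Hd h h0 hd th; rewrite /L2norm (eq_intab (g := fun x =>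
  ((rhot (t + h) x - rhot t x) / h - P t x * rho t x) ^+ 2)) => [//|x x01].
by rewrite fop_pot//; [exact: lr|exact: ls].
Qed.

Let cA : jcont A.
Proof. by apply: pot_jcont; [exact: L2loc_deriv_L2_curve lr ls dr|exact: L2loc_deriv_L2_curve ls lPr ds]. Qed.

(* [rho t] and [rhot t] agree almost everywhere with the pointwise solution of the linear
   equation, whose coefficient gains one derivative in x over its arguments. *)
Lemma solution_smooth j (b : R -> R) : smooth j (fun _ => b) ->
  aeq (rho 0) (fun=> 1) -> aeq (rhot 0) b ->
  exists2 phi, smooth j phi & forall t, 0 <= t -> aeq (rho t) (phi t).
Proof.
move=> sb er es.
have cb : continuous b by exact: jcont2 0 (smooth_jcont sb).
pose c t x := 1 + t * b x.
have sc : smooth j c.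
  apply: smoothD; first exact: smooth_cst.
  by apply: smoothM => //; apply: (smooth_time j (h := id)) => x; exact: cvg_id.
have [phi cphi V] := volterra_exists cA (smooth_jcont sc).
have cAp := jcontM cA cphi.
pose psi t x := b x + vprim (fun t x => A t x * phi t x) t x.
have cpsi : jcont psi by apply: jcontD; [exact: jcont_space|exact: jcont_vprim].
have AP t : 0 <= t -> A t = P t by move=> t0; rewrite /A max_r.
have lphi t : l2 (phi t) by apply: l2_cont; exact: jcont2.
have lpsi t : l2 (psi t) by apply: l2_cont; exact: jcont2.
have lAp t : l2 (fun x => A t x * phi t x) by apply: l2_mulc => //; exact: jcont2.
have dz t : 0 <= t -> L2loc_deriv (fun t x => rho t x - phi t x) (fun t x => rhot t x - psi t x) t.
  move=> t0; apply: (L2loc_derivB t0 lr _ (ls t0) _ (dr t0)) => //.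
  exact: (volterra_L2loc_deriv cA cb cphi V t0).1.
have dw t : 0 <= t -> L2loc_deriv (fun t x => rhot t x - psi t x)
    (fun t x => A t x * (rho t x - phi t x)) t.
  move=> t0.
  have h := L2loc_derivB t0 ls (fun s _ => lpsi s) (lPr t0) (lAp t) (ds t0)
    (volterra_L2loc_deriv cA cb cphi V t0).2.
  by apply: L2loc_deriv_eq h => x; rewrite AP// mulrBr.
have z0 M : intab (- M) M (fun x => (rho 0 x - phi 0 x) ^+ 2) = 0.
  have e0 : phi 0 = fun=> 1.
    by apply/funext => x; rewrite V /c mul0r addr0 /vop /vprim {1}/prim intab_xx addr0.
  have [_ l] := l2B (lr (lexx 0)) (lphi 0).
  rewrite (aeq_intab (g := fun=> 0) _ _ l (@lint_cst _ 0)); last first.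
    rewrite e0 => a a'; have := er a a'; apply: filterS => x h xa.
    by rewrite h// subrr expr0n.
  have [M0|M0] := ltP M 0; first by rewrite intab_gt//; lra.
  by rewrite intab_cst ?mul0r//; lra.
have w0 M : intab (- M) M (fun x => (rhot 0 x - psi 0 x) ^+ 2) = 0.
  have e0 : psi 0 = b.
    by apply/funext => x; rewrite /psi /vprim {1}/prim intab_xx addr0.
  have [_ l] := l2B (ls (lexx 0)) (lpsi 0).
  rewrite (aeq_intab (g := fun=> 0) _ _ l (@lint_cst _ 0)); last first.
    rewrite e0 => a a'; have := es a a'; apply: filterS => x h xa.
    by rewrite h// subrr expr0n.
  have [M0|M0] := ltP M 0; first by rewrite intab_gt//; lra.
  by rewrite intab_cst ?mul0r//; lra.
have lzw t : 0 <= t -> l2 (fun x => rho t x - phi t x) /\ l2 (fun x => rhot t x - psi t x).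
  by move=> t0; split; apply: l2B; auto.
have E t (t0 : 0 <= t) M := l2_gronwall (M := M) cA lzw dz dw (z0 M) (w0 M) t0.
have Er t : 0 <= t -> aeq (rho t) (phi t).
  by move=> t0; apply: aeq_of_sq => [||M]; [exact: lr| |case: (E t t0 M)].
have Es t : 0 <= t -> aeq (rhot t) (psi t).
  by move=> t0; apply: aeq_of_sq => [||M]; [exact: ls| |case: (E t t0 M)].
exists phi => //.
suff [//] : smooth j phi /\ smooth j A.
(* Bootstrap: phi and A of order i give psi of order i, hence A of order i + 1 by its formula in
   (phi, psi), and the linear equation passes this order on to phi. *)
have H i : (i <= j)%N -> smooth i phi /\ smooth i A.
  elim: i => [_|i IHi ij]; first by split.
  have [sphi sA] := IHi (ltnW ij).
  have spsi : smooth i psi.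
    apply: smoothD; first exact: smooth_le (ltnW ij) sb.
    by apply: smooth_vprim; exact: smoothM.
  have sA' : smooth i.+1 A.
    have := pot_smooth m (smooth_clip sphi) (smooth_clip spsi).
    rewrite (_ : (fun _ _ => _) = A)//; apply/funext => t.
    have t0 : 0 <= Num.max 0 t by rewrite le_max lexx.
    rewrite /A /P (pot_aeq m (lr t0) (ls t0) (lphi (Num.max 0 t)) (lpsi (Num.max 0 t))) //.
      exact: Er.
    exact: Es.
  by split=> //; apply: smooth_volterra V => //; exact: smooth_le ij sc.
exact: H.
Qed.

End Solution.

Theorem theorem2 (R : realType) (u0 du0 : R -> R) (rho rhot : R -> R -> R)
  (* u0 in H^1(S^1): u0 (continuous representative) is 1-periodic and the
     integral of its L^2 weak derivative du0 *)
  (Hu0p : periodic1 u0) (Hdu0p : periodic1 du0) (Hdu0 : inL2 du0)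
  (Hu0 : forall x, u0 x = u0 0 + oint 0 x du0)
  (* (rho, rho_t) : [0,oo) -> L^2(S^1) x L^2(S^1) solves the Cauchy problem *)
  (Hrp : forall t : R, 0 <= t -> periodic1 (rho t) /\ periodic1 (rhot t))
  (Hr2 : forall t : R, 0 <= t -> inL2 (rho t) /\ inL2 (rhot t))
  (Hode1 : forall t : R, 0 <= t -> L2_deriv_at rho rhot t)
  (Hode2 : forall t : R, 0 <= t ->
     L2_deriv_at rhot (fun s => fop (intab 0 1 u0) (rho s) (rhot s)) t)
  (Hinit1 : L2norm (fun x => rho 0 x - 1) = 0)
  (Hinit2 : L2norm (fun x => rhot 0 x - du0 x / 2) = 0)
  (Hnorm : forall t : R, 0 <= t -> intab 0 1 (fun x => rho t x ^+ 2) = 1) :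
  (forall t : R, 0 <= t -> forall a b : R, a <= b -> abs_cont_on a b (lagr_flow u0 rho rhot t)) /\
  (forall k : nat, (1 <= k)%N -> Ck k u0 ->
     forall t : R, 0 <= t -> Ck k (lagr_flow u0 rho rhot t)).
Proof.
have lr (t : R) : 0 <= t -> l2 (rho t).
  by move=> t0; apply: inL2_l2; [case: (Hrp t t0)|case: (Hr2 t t0)].
have lr2 (t : R) : 0 <= t -> lint (fun x => rho t x ^+ 2) by move=> /lr[].
split=> [t t0 a b _|k k1 Ck0 t t0].
  (* As a function of x, the flow is the primitive of rho^2 plus a constant. *)
  rewrite /lagr_flow; under [X in abs_cont_on _ _ X]funext => x do rewrite -addrA.
  by apply: abs_cont_oint => [|x]; [exact: lr2|exact: sqr_ge0].
have t00 : 0 <= (0 : R) by [].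
have [pr ps] := Hrp 0 t00; have ls0 : l2 (rhot 0) by apply: inL2_l2; case: (Hr2 0 t00).
have ldu0 := inL2_l2 Hdu0p Hdu0.
case: k k1 Ck0 => [|k] k1 Ck0; first case: (notF k1).
have cdu : continuous (derive1 u0) by exact: (Ck_continuous (i := 1) Ck0).
(* [du0] is only a weak derivative: it has the same primitive as the classical one, hence agrees
   with it almost everywhere. *)
have edu : aeq (fun x => du0 x - derive1 u0 x) (fun=> 0).
  have ld := lint_cont cdu.
  apply: aeq_of_oint => [|x y]; first exact: lintB ldu0.1 ld.
  rewrite ointB//; last exact: ldu0.1.
  have h (z : R) : oint 0 z (derive1 u0) - u0 z = - u0 0.
    have dh (w : R) : is_derive w 1 (fun z => oint 0 z (derive1 u0) - u0 z) 0.
      have [d _] := Ck0; have h1 := is_derive_derive1 (d 0%N isT w).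
      have h2 := is_derive_oint 0 w cdu.
      by apply: is_derive_eq; rewrite subrr.
    by have := is_derive_0_is_cst z 0 dh; rewrite ointxx sub0r.
  have g (z : R) : oint 0 z du0 = oint 0 z (derive1 u0).
    by have := h z; have := Hu0 z; lra.
  by rewrite (oint_split 0 x y ldu0.1) (oint_split 0 x y ld) !(ointC x) !g subrr.
have er : aeq (rho 0) (fun=> 1).
  have l1 : l2 (fun _ : R => 1) by apply: l2_cont => x; exact: cst_continuous.
  apply: aeq_of_sq => [||M]; [exact: lr|by []|].
  apply: (L2norm_periodic (f := fun x => rho 0 x - 1)) => //.
    by move=> x; rewrite pr.
  by apply: l2B => //; exact: lr.
have es : aeq (rhot 0) (fun x => derive1 u0 x / 2).
  have lh : l2 (fun x => du0 x / 2).
    rewrite (_ : (fun _ => _) = fun x => 2^-1 * du0 x); first exact: l2Z.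
    by apply/funext => x; rewrite mulrC.
  have e1 : aeq (rhot 0) (fun x => du0 x / 2).
    apply: aeq_of_sq => // M.
    apply: (L2norm_periodic (f := fun x => rhot 0 x - du0 x / 2)) => //.
      by move=> x; rewrite ps Hdu0p.
    exact: l2B.
  move=> a b; have := e1 a b; have := edu a b; apply: filterS2 => x h1 h2 xab.
  by rewrite h2//; congr (_ / 2); have := h1 xab; move/eqP; rewrite subr_eq0 => /eqP.
(* Here u0 is C^{k+1}, so u0'/2 and with it phi have order k; the primitive of phi^2 recovers the
   missing order. *)
have [phi sphi E] := solution_smooth Hrp Hr2 Hode1 Hode2 Hnorm (Ck_smooth_half Ck0) er es.
set c := t * u0 0 - oint 0 t (fun tau => oint 0 tau (fun s => Hop (intab 0 1 u0) (rho s) (rhot s) 0)).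
have -> : lagr_flow u0 rho rhot t = fun x => oint 0 x (fun y => phi t y ^+ 2) + c.
  apply/funext => x; rewrite /lagr_flow -addrA; congr (_ + _).
  apply: aeq_oint; first exact: lr2.
    by have [] : l2 (phi t) by apply: l2_cont; exact: jcont2 (smooth_jcont sphi).
  exact: (aeq_op (fun _ p _ => p ^+ 2) (E t t0) (E t t0)).
apply: (smooth_Ck (f := fun t x => oint 0 x (fun y => phi t y ^+ 2) + c)).
apply: smoothD; last exact: smooth_cst.
by apply: smooth_oint; exact: smoothM.
Qed.
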